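(* Let $U_\hbar(\mathfrak g)$ be a QUEA and let $\sigma=\exp_*(\hbar^{-1}\chi)$ be a polar 2-cocycle for $U_\hbar(\mathfrak g)$, with $\chi\in(U_\hbar(\mathfrak g)^{\widehat\otimes2})^*$. Set $\chi':=\hbar^{-1}\log_*(\sigma)=\hbar^{-2}\chi$, $\chi_a:=\chi-\chi_{2,1}$ and $\chi'_a:=\chi'-\chi'_{2,1}$. Then: (a) $\chi$ is antisymmetric (i.e. $\chi_{2,1}=-\chi$) iff $\sigma$ is orthogonal (i.e. $\sigma_{2,1}=\sigma^{-1}$) iff $\chi'$ is antisymmetric (i.e. $\chi'_{2,1}=-\chi'$); (b) $\sigma=\exp_*(\hbar\,\chi')$ (restricted to $U_\hbar(\mathfrak g)'\times U_\hbar(\mathfrak g)'$) is a 2-cocycle for the QFSHA $F_\hbar[[G^*]]:=U_\hbar(\mathfrak g)'$; (c) let $\gamma:=(\chi_a\bmod\hbar)\big|_{\mathfrak g\otimes\mathfrak g}$ be the antisymmetric 2-cocycle of the Lie bialgebra $\mathfrak g$ attached to the polar 2-cocycle $\sigma$ of $U_\hbar(\mathfrak g)$, and let $\gamma'$ be the antisymmetric 2-cocycle of $\mathfrak g^{**}=\mathfrak g$ attached to the 2-cocycle $\sigma$ of the QFSHA $F_\hbar[[G^*]]=U_\hbar(\mathfrak g)'$, i.e. the form induced by $(\chi'_a\bmod\hbar)$ on $(\mathfrak m_{G^*}/\mathfrak m_{G^*}^2)^{\otimes2}=\mathfrak g\otimes\mathfrak g$, where $\mathfrak m_{G^*}=\mathrm{Ker}(\epsilon_{F[[G^*]]})$.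 Then $\gamma=\gamma'$.
   Context: $\Bbbk$ is a field of characteristic $0$. $\widehat\otimes$ is the $\hbar$-adically completed tensor product of topologically free $\Bbbk[[\hbar]]$-modules (those $\cong V[[\hbar]]$). For topological modules $\cong\Bbbk[[\hbar]]^{E}$ with the weak (product) topology, $\widetilde\otimes$ is the completed tensor product with $\Bbbk[[\hbar]]^{E_1}\widetilde\otimes\,\Bbbk[[\hbar]]^{E_2}\cong\Bbbk[[\hbar]]^{E_1\times E_2}$. QUEA: a topologically free topological Hopf algebra $U_\hbar=U_\hbar(\mathfrak g)$ (for $\widehat\otimes$) with $U_\hbar/\hbar U_\hbar\cong U(\mathfrak g)$ as Hopf algebras for a Lie algebra $\mathfrak g$ (finite-dimensional here); $\mathfrak g$ is a Lie bialgebra via $\delta(x)=\hbar^{-1}(\Delta(x')-\Delta^{\mathrm{op}}(x'))\bmod\hbar$. QFSHA: a topological Hopf algebra $F_\hbar=F_\hbar[[K]]$ of type $\Bbbk[[\hbar]]^E$ (for $\widetilde\otimes$) with $F_\hbar/\hbar F_\hbar$ commutative and complete in the adic topology of its augmentation ideal, i.e. $\cong F[[K]]$ for a formal group $K$, which is Poisson via $\{x,y\}=\hbar^{-1}(x'y'-y'x')\bmod\hbar$. Drinfeld functor: $U_\hbar(\mathfrak g)':=\{\eta\in U_\hbar(\mathfrak g)\mid\delta_n(\eta)\in\hbar^nU_\hbar(\mathfrak g)^{\widehat\otimes n}\ \forall n\ge0\}$, $\delta_n=(\mathrm{id}-\iota\circ\epsilon)^{\otimes n}\circ\Delta^{(n-1)}$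 ($\iota$ the unit map). It is a QFSHA over a formal Poisson group $G^*$ with tangent Lie bialgebra $\mathfrak g^*$; its cotangent Lie bialgebra $\mathfrak m_{G^*}/\mathfrak m_{G^*}^2$ is identified with $\mathfrak g^{**}=\mathfrak g$ by: if $y\in U_\hbar(\mathfrak g)$ lifts $\mathrm y\in\mathfrak g$, $\epsilon(y)=0$ and $\hbar y\in U_\hbar(\mathfrak g)'$, the class of $\hbar y$ corresponds to $\mathrm y$. 2-cocycle for $H$: a convolution invertible bilinear form with $\sigma(a,1)=\epsilon(a)=\sigma(1,a)$ and $\sigma(a_{(1)},b_{(1)})\sigma(a_{(2)}b_{(2)},c)=\sigma(b_{(1)},c_{(1)})\sigma(a,b_{(2)}c_{(2)})$; convolution is $(\alpha*\beta)(a,b)=\alpha(a_{(1)},b_{(1)})\beta(a_{(2)},b_{(2)})$, with $\exp_*,\log_*$; subscript $2,1$ exchanges arguments. Polar 2-cocycle of $U=U_\hbar(\mathfrak g)$: $\sigma=\exp_*(\hbar^{-1}\chi)=\sum_n\hbar^{-n}\chi^{*n}/n!$, a $\Bbbk((\hbar))$-valued bilinear form on $\Bbbk((\hbar))\otimes_{\Bbbk[[\hbar]]}U$, where $\chi\in(U^{\widehat\otimes2})^*$, $\chi(z,1)=0=\chi(1,z)$ for all $z$, satisfying the 2-cocycle identity (read on the $\hbar$-adically dense subalgebra $\bigcup_n\hbar^{-n}(I')^n$ of $U$, $I'=\hbar U'+\mathrm{Ker}(\epsilon_{U'})$, where the series converges). Known facts used to formulate (c): $\gamma$ and $\gamma'$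 are well-defined antisymmetric 2-cocycles of the Lie bialgebra $\mathfrak g$, i.e. antisymmetric forms with $\mathrm{ad}_\psi(\partial_*\gamma+[[\gamma,\gamma]]_* )=0$ for all $\psi\in\mathfrak g^*$, where $(\partial_*\gamma)(a,b,c)=\gamma([a,b],c)+$ cyclic permutations and $[[\gamma,\gamma]]_*=[\gamma_{12},\gamma_{13}]+[\gamma_{12},\gamma_{23}]+[\gamma_{13},\gamma_{23}]$ is computed in the dual Lie algebra $\mathfrak g^*$. *)

(* Defs.v *)
From HB Require Import structures.
From mathcomp Require Import all_boot all_order all_algebra.
From mathcomp Require Import boolp.
Set Implicit Arguments.
Unset Strict Implicit.
Unset Printing Implicit Defensive.
Set Warnings "-redundant-canonical-projection".
Import GRing.Theory.
Local Open Scope ring_scope.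

(* MathComp world; [boolp] is only used for the choiceType of k[[hbar]] and for
   functional extensionality. *)

(** * The ring k[[hbar]] and the field k((hbar)) *)

Record fps (k : nzRingType) : Type := Fps { coefs :> nat -> k }.

HB.instance Definition _ (k : nzRingType) := gen_eqMixin (fps k).
HB.instance Definition _ (k : nzRingType) := gen_choiceMixin (fps k).

Lemma fpsP (k : nzRingType) (a b : fps k) : (forall n, a n = b n) -> a = b.
Proof. by case: a b => [a] [b] /= ab; congr Fps; apply/funext. Qed.

Section FpsRing.
Variable k : comNzRingType.
Implicit Types a b c : fps k.

Definition fps_zero : fps k := Fps (fun=> 0).
Definition fps_opp a : fps k := Fps (fun n => - a n).
Definition fps_add a b : fps k := Fps (fun n => a n + b n).
Definition fpsC (x : k) : fps k := Fps (fun n => if n == 0%N then x else 0).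
Definition fps_mul a b : fps k :=
  Fps (fun n => \sum_(i < n.+1) a i * b (n - i)%N).

Fact fps_addA : associative fps_add.
Proof. by move=> a b c; apply: fpsP => n /=; rewrite addrA. Qed.
Fact fps_addC : commutative fps_add.
Proof. by move=> a b; apply: fpsP => n /=; rewrite addrC. Qed.
Fact fps_add0 : left_id fps_zero fps_add.
Proof. by move=> a; apply: fpsP => n /=; rewrite add0r. Qed.
Fact fps_addN : left_inverse fps_zero fps_opp fps_add.
Proof. by move=> a; apply: fpsP => n /=; rewrite addNr. Qed.

HB.instance Definition _ :=
  GRing.isZmodule.Build (fps k) fps_addA fps_addC fps_add0 fps_addN.

Definition fps_trunc m a : {poly k} := \poly_(i < m) a i.

Lemma fps_mul_trunc m n a b : (n < m)%N ->
  fps_mul a b n = (fps_trunc m a * fps_trunc m b)`_n.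
Proof.
move=> nm; rewrite coefM /=; apply: eq_bigr => i _.
rewrite !coef_poly (leq_ltn_trans (leq_subr i n) nm).
by rewrite (leq_ltn_trans _ nm) // -ltnS.
Qed.

Lemma coefM_ext (p p' q q' : {poly k}) n :
  (forall i, (i <= n)%N -> p`_i = p'`_i) ->
  (forall i, (i <= n)%N -> q`_i = q'`_i) -> (p * q)`_n = (p' * q')`_n.
Proof.
move=> pp qq; rewrite !coefM; apply: eq_bigr => i _.
by rewrite pp ?qq ?leq_subr // -ltnS.
Qed.

Fact fps_mulA : associative fps_mul.
Proof.
move=> a b c; apply: fpsP => n.
have mulT x y i : (i <= n)%N ->
    (fps_trunc n.+1 (fps_mul x y))`_i = (fps_trunc n.+1 x * fps_trunc n.+1 y)`_i.
  by move=> le_in; rewrite coef_poly ltnS le_in (@fps_mul_trunc n.+1).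
rewrite !(@fps_mul_trunc n.+1 n) //.
rewrite (@coefM_ext _ (fps_trunc n.+1 a) _ (fps_trunc n.+1 b * fps_trunc n.+1 c)) //;
  last exact: mulT.
by rewrite mulrA; apply: coefM_ext => // i /mulT ->.
Qed.

Fact fps_mulC : commutative fps_mul.
Proof.
by move=> a b; apply: fpsP => n; rewrite !(@fps_mul_trunc n.+1 n) // mulrC.
Qed.

Fact fps_mul1 : left_id (fpsC 1) fps_mul.
Proof.
move=> a; apply: fpsP => n /=; rewrite big_ord_recl /= mul1r subn0.
by rewrite big1 ?addr0 // => i _; rewrite mul0r.
Qed.

Fact fps_mulDl : left_distributive fps_mul fps_add.
Proof.
move=> a b c; apply: fpsP => n /=; rewrite -big_split /=.
by apply: eq_bigr => i _; rewrite mulrDl.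
Qed.

Fact fps_1_neq0 : fpsC 1 != 0 :> fps k.
Proof.
apply/eqP => /(congr1 (fun a : fps k => a 0%N)) /= /eqP.
by rewrite (oner_eq0 k).
Qed.

HB.instance Definition _ := GRing.Zmodule_isComNzRing.Build (fps k)
  fps_mulA fps_mulC fps_mul1 fps_mulDl fps_1_neq0.

Definition hbar : fps k := Fps (fun n => (n == 1%N)%:R).

(** [hord n c] : c is divisible by hbar^n *)
Definition hord (n : nat) (c : fps k) : Prop := forall i, (i < n)%N -> c i = 0.

Definition hcvg (u : nat -> fps k) (l : fps k) : Prop :=
  forall r, exists N0, forall N, (N0 <= N)%N -> hord r (u N - l).

Record laurent : Type := Laurent {
  lcoef :> int -> k;
  lcoef_bounded : exists m : int, forall i : int, i < m -> lcoef i = 0 }.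

(** the coefficients of hbar^(-d) c *)
Definition polar_coef (d : nat) (c : fps k) (i : int) : k :=
  if i + d%:Z is Posz n then c n else 0.

(** hbar-adic convergence of hbar^(- d N) * u N in k((hbar)) *)
Definition laurent_cvg (d : nat -> nat) (u : nat -> fps k) (l : laurent) : Prop :=
  forall r : int, exists N0, forall N, (N0 <= N)%N ->
    forall i : int, i < r -> polar_coef (d N) (u N) i = l i.

Fact polar_coef_bounded (c : fps k) :
  exists m : int, forall i : int, i < m -> polar_coef 0 c i = 0.
Proof. by exists 0 => -[]. Qed.

Definition fps_laurent (c : fps k) : laurent := Laurent (polar_coef_bounded c).

End FpsRing.

Arguments hbar {k}.

(** * Modules over k[[hbar]] and forms on them

   Tensors are represented by the values that (continuous) multilinear forms
   take on them: an element t of a completed tensor power of M is the functional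
   sending a multilinear form beta to beta(t).  Thus [cop a (fun x y => ..)] is
   the Sweedler expression ".. a_(1) .. a_(2) ..". An n-ary form is written as a
   function on sequences, of which only the values at length n matter, and a
   functional only matters through its values at the admissible forms. *)

Section Modules.
Variable k : fieldType.
Local Notation K := (fps k).
Variable M : lmodType K.

Definition topfree : Prop :=
  exists (V : lmodType k) (phi : M -> nat -> V),
    [/\ bijective phi,
        forall x y n, phi (x + y) n = phi x n + phi y n
      & forall c x n, phi (c *: x) n = \sum_(i < n.+1) c i *: phi x (n - i)%N].

Definition in_hpow (n : nat) (x : M) : Prop := exists y, x = hbar ^+ n *: y.

Definition mlin (n : nat) (beta : seq M -> K) : Prop :=
  forall (s1 s2 : seq M) (c : K) (x y : M), (size s1 + size s2).+1 = n ->
  beta (s1 ++ (c *: x + y) :: s2) =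
    c * beta (s1 ++ x :: s2) + beta (s1 ++ y :: s2).

(** The hbar-adically completed n-th tensor power of a topologically free M:
    functionals which modulo each hbar^N are given by an element of the algebraic
    tensor power.  Since multilinear forms separate the points of the completed
    tensor power and detect divisibility by hbar there, this is faithful. *)
Definition ctens (n : nat) (t : (seq M -> K) -> K) : Prop :=
  forall N, exists L : seq (K * seq M), all (fun p => size p.2 == n) L /\
    forall beta, mlin n beta ->
      hord N (t beta - \sum_(p <- L) p.1 * beta p.2).

Definition ctens2 (t : (M -> M -> K) -> K) : Prop :=
  ctens 2 (fun beta => t (fun x y => beta [:: x; y])).

(** a topology of type K^E, transported from the product topology *)
Definition weak_coord (E : eqType) (coord : M -> E -> K) : Prop :=
  bijective coord /\
  forall c x y e, coord (c *: x + y) e = c * coord x e + coord y e.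

Section Weak.
Variables (E : eqType) (coord : M -> E -> K).

Definition wnbhs0 (S : seq E) (m : nat) (x : M) : Prop :=
  forall e, e \in S -> hord m (coord x e).

Definition cmlin (n : nat) (beta : seq M -> K) : Prop :=
  mlin n beta /\
  forall (s : seq M) (N : nat), size s = n -> exists (S : seq E) (m : nat),
    forall s' : seq M, size s' = n ->
      (forall i, (i < n)%N -> wnbhs0 S m (s'`_i - s`_i)) ->
      hord N (beta s' - beta s).

(** The completed tensor square for the weak topology: the continuous bilinear
    forms on K^E are the families on E * E tending to 0, and the linear functionals
    on these are exactly the families in K^(E * E). *)
Definition wtens2 (t : (M -> M -> K) -> K) : Prop :=
  forall (c : K) (a b : M -> M -> K),
    cmlin 2 (fun s => a s`_0 s`_1) -> cmlin 2 (fun s => b s`_0 s`_1) ->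
    t (fun x y => c * a x y + b x y) = c * t a + t b.

End Weak.
End Modules.

(** * Topological Hopf algebras, convolution and 2-cocycles *)

Section Hopf.
Variable k : fieldType.
Local Notation K := (fps k).
Variable H : algType K.

Record hopf_ops : Type := HopfOps {
  cop : H -> (H -> H -> K) -> K;
  eps : H -> K;
  anti : H -> H }.

(** [form] is the class of (continuous) multilinear forms, and [tens2] the
    completed tensor square, of the category of topological modules at hand. *)
Variables (form : nat -> (seq H -> K) -> Prop)
          (tens2 : ((H -> H -> K) -> K) -> Prop).

Definition form1 (l : H -> K) : Prop := form 1 (fun s => l s`_0).
Definition form2 (b : H -> H -> K) : Prop := form 2 (fun s => b s`_0 s`_1).
Definition form3 (b : H -> H -> H -> K) : Prop :=
  form 3 (fun s => b s`_0 s`_1 s`_2).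

Variable O : hopf_ops.

Record top_hopf : Prop := TopHopf {
  (* continuity of the structure maps *)
  hopf_mul_cont : forall l, form1 l -> form2 (fun x y => l (x * y));
  hopf_cop_cont : forall b, form2 b -> form1 (fun a => cop O a b);
  hopf_eps_cont : form1 (eps O);
  hopf_anti_cont : forall l, form1 l -> form1 (fun x => l (anti O x));
  (* coalgebra *)
  hopf_cop_tens : forall a, tens2 (cop O a);
  hopf_coassoc : forall a b, form3 b ->
    cop O a (fun x y => cop O y (fun y1 y2 => b x y1 y2)) =
    cop O a (fun x y => cop O x (fun x1 x2 => b x1 x2 y));
  hopf_counitl : forall a l, form1 l -> cop O a (fun x y => eps O x * l y) = l a;
  hopf_counitr : forall a l, form1 l -> cop O a (fun x y => l x * eps O y) = l a;
  (* bialgebra *)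
  hopf_copM : forall a b f, form2 f ->
    cop O (a * b) f =
    cop O a (fun a1 a2 => cop O b (fun b1 b2 => f (a1 * b1) (a2 * b2)));
  hopf_cop1 : forall f, form2 f -> cop O 1 f = f 1 1;
  hopf_epsM : forall a b, eps O (a * b) = eps O a * eps O b;
  hopf_eps1 : eps O 1 = 1;
  (* antipode *)
  hopf_antil : forall a l, form1 l ->
    cop O a (fun x y => l (anti O x * y)) = eps O a * l 1;
  hopf_antir : forall a l, form1 l ->
    cop O a (fun x y => l (x * anti O y)) = eps O a * l 1 }.

Definition conv (f g : H -> H -> K) : H -> H -> K := fun a b =>
  cop O a (fun a1 a2 => cop O b (fun b1 b2 => f a1 b1 * g a2 b2)).

Definition conv1 : H -> H -> K := fun a b => eps O a * eps O b.

Definition conv_pow (f : H -> H -> K) (n : nat) : H -> H -> K :=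
  iter n (conv f) conv1.

Definition flip (f : H -> H -> K) : H -> H -> K := fun a b => f b a.

Definition antisym (f : H -> H -> K) : Prop := forall a b, flip f a b = - f a b.

(** s = exp_*(f) and f = log_*(s), the series converging hbar-adically *)
Definition is_exp_conv (f s : H -> H -> K) : Prop := forall a b,
  hcvg (fun N => \sum_(n < N) fpsC (n`!%:R^-1) * conv_pow f n a b) (s a b).

Definition is_log_conv (s f : H -> H -> K) : Prop := forall a b,
  hcvg (fun N => \sum_(1 <= n < N) fpsC ((-1) ^+ n.+1 / n%:R) *
                   conv_pow (fun x y => s x y - conv1 x y) n a b) (f a b).

Definition is_2cocycle (s : H -> H -> K) : Prop :=
  [/\ form2 s,
      exists t, [/\ form2 t, conv s t =2 conv1 & conv t s =2 conv1],
      forall a, s a 1 = eps O a /\ s 1 a = eps O a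
    & forall a b c,
        cop O a (fun a1 a2 => cop O b (fun b1 b2 => s a1 b1 * s (a2 * b2) c)) =
        cop O b (fun b1 b2 => cop O c (fun c1 c2 => s b1 c1 * s a (b2 * c2)))].

(** For a subalgebra W: the ideal hbar W + Ker(eps|W) and its powers. *)
Definition aug_ideal (W : H -> Prop) (a : H) : Prop :=
  exists b c, [/\ W b, W c, eps O c = 0 & a = hbar *: b + c].

Fixpoint aug_pow (W : H -> Prop) (n : nat) (a : H) : Prop :=
  if n is n'.+1 then
    exists L : seq (H * H),
      (forall p, p \in L -> aug_ideal W p.1 /\ aug_pow W n' p.2) /\
      a = \sum_(p <- L) p.1 * p.2
  else W a.

End Hopf.

(** * Lie algebras and their universal enveloping algebras *)

Section Lie.
Variables (k : fieldType) (g : vectType k).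

Record is_lie (br : g -> g -> g) : Prop := IsLie {
  lie_linl : forall z, linear (br^~ z);
  lie_linr : forall z, linear (br z);
  lie_alt : forall x, br x x = 0;
  lie_jacobi : forall x y z,
    br x (br y z) + br y (br z x) + br z (br x y) = 0 }.

Variable br : g -> g -> g.

Definition lie_hom (B : algType k) (f : g -> B) : Prop :=
  forall x y, f (br x y) = f x * f y - f y * f x.

Definition is_enveloping (A : algType k) (i : {linear g -> A}) : Prop :=
  lie_hom i /\
  forall (B : algType k) (f : {linear g -> B}), lie_hom f ->
    exists h : {lrmorphism A -> B}, (forall x, h (i x) = f x) /\
      forall h' : {lrmorphism A -> B}, (forall x, h' (i x) = f x) -> h' =1 h.

End Lie.

(** * Quantised universal enveloping algebras *)

Record QUEA (k : fieldType) (g : vectType k) (br : g -> g -> g) : Type := {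
  quea :> algType (fps k);
  quea_ops : hopf_ops quea;
  quea_topfree : topfree quea;
  quea_hopf : top_hopf (@mlin k quea) (@ctens2 k quea) quea_ops;
  (* [env] is U(g), and [red] induces an isomorphism of U_h / hbar U_h onto it *)
  env : algType k;
  env_in : {linear g -> env};
  env_univ : is_enveloping br env_in;
  red : {rmorphism quea -> env};
  redZ : forall c a, red (c *: a) = c 0%N *: red a;
  red_surj : forall u, exists a, red a = u;
  red_ker : forall a, red a = 0 <-> in_hpow 1 a;
  (* this is an isomorphism for the Hopf algebra structure of U(g), the one for
     which the elements of g are primitive *)
  red_prim : forall x a, red a = env_in x ->
    exists t, ctens2 t /\ forall b, form2 (@mlin k quea) b ->
      cop quea_ops a b - b a 1 - b 1 a = hbar * t b;
  red_eps : forall x a, red a = env_in x -> hord 1 (eps quea_ops a);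
  red_anti : forall x a, red a = env_in x -> in_hpow 1 (anti quea_ops a + a) }.

Section Drinfeld.
Variables (k : fieldType) (g : vectType k) (br : g -> g -> g) (U : QUEA br).
Local Notation K := (fps k).
Local Notation O := (quea_ops U).

(** [delta n a beta] is beta(delta_n(a)), using
    delta_(n+1) = ((id - iota eps) (x) delta_n) Delta and delta_0 = eps. *)
Fixpoint delta (n : nat) (a : U) (beta : seq U -> K) : K :=
  if n is n'.+1 then
    cop O a (fun x y => delta n' y (fun s => beta ((x - eps O x *: 1) :: s)))
  else eps O a * beta [::].

Definition drinfeld (a : U) : Prop := forall n, exists t, ctens n t /\
  forall beta, mlin n beta -> delta n a beta = hbar ^+ n * t beta.

(** the dense subalgebra given by the union of the hbar^(-n) (I')^n *)
Definition polar_dom (a : U) : Prop :=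
  exists n, aug_pow O drinfeld n (hbar ^+ n *: a).

(** hbar^N times the N-th partial sum of exp_*(hbar^(-1) chi) *)
Definition polar_num (chi : U -> U -> K) (N : nat) : U -> U -> K := fun a b =>
  \sum_(n < N.+1) hbar ^+ (N - n) * fpsC (n`!%:R^-1) * conv_pow O chi n a b.

(** sigma(a, b) = l, where sigma = exp_*(hbar^(-1) chi) *)
Definition polar_exp (chi : U -> U -> K) (a b : U) (l : laurent k) : Prop :=
  laurent_cvg id (fun N => polar_num chi N a b) l.

(** In both sides of the cocycle identity, and in convolution products, sigma is
    replaced by its partial sums, and the limit is taken in k((hbar)). *)
Definition polar_2cocycle (chi : U -> U -> K) : Prop :=
  [/\ form2 (@mlin k U) chi,
      forall z, chi z 1 = 0 /\ chi 1 z = 0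
    & forall a b c, polar_dom a -> polar_dom b -> polar_dom c ->
      exists l : laurent k,
        laurent_cvg (fun N => (N + N)%N) (fun N =>
          cop O a (fun a1 a2 => cop O b (fun b1 b2 =>
            polar_num chi N a1 b1 * polar_num chi N (a2 * b2) c))) l /\
        laurent_cvg (fun N => (N + N)%N) (fun N =>
          cop O b (fun b1 b2 => cop O c (fun c1 c2 =>
            polar_num chi N b1 c1 * polar_num chi N a (b2 * c2)))) l].

(** sigma_(2,1) is the convolution inverse of sigma *)
Definition polar_orthogonal (chi : U -> U -> K) : Prop :=
  forall a b, polar_dom a -> polar_dom b ->
    let sg N := polar_num chi N in
    laurent_cvg (fun N => (N + N)%N) (fun N => conv O (sg N) (flip (sg N)) a b)
      (fps_laurent (conv1 O a b)) /\
    laurent_cvg (fun N => (N + N)%N) (fun N => conv O (flip (sg N)) (sg N) a b)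
      (fps_laurent (conv1 O a b)).

(** gamma = (chi_a mod hbar) restricted to g (x) g *)
Definition quea_gamma (chi : U -> U -> K) (gamma : g -> g -> k) : Prop :=
  forall x y a b, red U a = env_in U x -> red U b = env_in U y ->
    gamma x y = (chi a b - flip chi a b) 0%N.

End Drinfeld.

(** * Quantised formal series Hopf algebras *)

(** The power m^n of the augmentation ideal m of F / hbar F, pulled back to F. *)
Definition mpow (k : fieldType) (F : algType (fps k)) (O : hopf_ops F)
    (n : nat) (a : F) : Prop :=
  exists b c, aug_pow O (fun=> True) n b /\ a = b + hbar *: c.

Record QFSHA (k : fieldType) : Type := {
  qf :> algType (fps k);
  qf_ops : hopf_ops qf;
  qf_index : eqType;
  qf_coord : qf -> qf_index -> fps k;
  qf_weak : weak_coord qf_coord;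
  qf_hopf : top_hopf (cmlin qf_coord) (wtens2 qf_coord) qf_ops;
  qf_comm : forall a b : qf, in_hpow 1 (a * b - b * a);
  qf_separated : forall a, (forall n, mpow qf_ops n a) -> in_hpow 1 a;
  qf_complete : forall u : nat -> qf,
    (forall n, mpow qf_ops n (u n.+1 - u n)) ->
    exists a, forall n, mpow qf_ops n (a - u n) }.

(** U_h(g)' as a QFSHA F_h[[G^*]]: [dd_in] identifies F, as a topological Hopf
    algebra, with U_h(g)', and [dd_cot], which matters only on the preimage of m,
    induces the isomorphism of m / m^2 onto g taking the class of hbar y to the
    element y0 of g lifted by y. *)
Record drinfeld_dual (k : fieldType) (g : vectType k) (br : g -> g -> g)
    (U : QUEA br) (F : QFSHA k) : Type := {
  dd_in : {lrmorphism F -> U};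
  dd_inj : injective dd_in;
  dd_image : forall u, drinfeld u <-> exists a, dd_in a = u;
  dd_cont : forall N, exists S m, forall a,
    wnbhs0 (qf_coord (q := F)) S m a -> in_hpow N (dd_in a);
  dd_cop : forall a b, form2 (@mlin k U) b ->
    cop (qf_ops F) a (fun x y => b (dd_in x) (dd_in y)) =
    cop (quea_ops U) (dd_in a) b;
  dd_eps : forall a, eps (quea_ops U) (dd_in a) = eps (qf_ops F) a;
  dd_anti : forall a, anti (quea_ops U) (dd_in a) = dd_in (anti (qf_ops F) a);
  dd_cot : F -> g;
  dd_cot_lin : forall c a b, mpow (qf_ops F) 1 a -> mpow (qf_ops F) 1 b ->
    dd_cot (c *: a + b) = c 0%N *: dd_cot a + dd_cot b;
  dd_cot_surj : forall x, exists2 a, mpow (qf_ops F) 1 a & dd_cot a = x;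
  dd_cot_ker : forall a, mpow (qf_ops F) 1 a ->
    (dd_cot a = 0 <-> mpow (qf_ops F) 2 a);
  dd_cotP : forall a x, mpow (qf_ops F) 1 a ->
    (dd_cot a = x <->
     exists y b, [/\ red U y = env_in U x, eps (quea_ops U) y = 0,
       dd_in b = hbar *: y & mpow (qf_ops F) 2 (a - b)]) }.

(** gamma' is the form induced by (chi'_a mod hbar) on m / m^2 = g *)
Definition qfsha_gamma (k : fieldType) (g : vectType k) (br : g -> g -> g)
    (U : QUEA br) (F : QFSHA k) (D : drinfeld_dual U F)
    (chi' : F -> F -> fps k) (gamma' : g -> g -> k) : Prop :=
  forall a b, mpow (qf_ops F) 1 a -> mpow (qf_ops F) 1 b ->
    gamma' (dd_cot D a) (dd_cot D b) = (chi' a b - flip chi' a b) 0%N.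

(* Main.v *)
From HB Require Import structures.
Require Import Defs.
From mathcomp Require Import all_boot all_order all_algebra.
From mathcomp Require Import boolp zify ring.
Set Implicit Arguments.
Unset Strict Implicit.
Unset Printing Implicit Defensive.
Import GRing.Theory.
Local Open Scope ring_scope.

(** An element of U' is a scalar modulo hbar, so chi takes values divisible by
   hbar^2 on U' and chi' = hbar^(-2) chi is a continuous form on F.  Convolution
   of continuous forms on F is associative, and power series can be evaluated at
   hbar chi' in the resulting hbar-adic algebra: sigma is the value of exp,
   log(exp(X)) = X gives the logarithm, and the cocycle identity is the limit of
   the polar one.

   (a) If sigma_(2,1) = sigma^(-1) then exp(hbar chi'_(2,1)) = exp(- hbar chi'), and
   taking logarithms chi' is antisymmetric.  This says that chi is antisymmetric on
   U', hence on U, since the elements hbar y with y lifting elements of g lie in U'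
   and so the union of the hbar^(-n) U' is dense.

   (c) Modulo hbar, chi' is a Hochschild 2-cocycle on the commutative algebra
   F / hbar F with trivial coefficients.  Its antisymmetrization is therefore a
   derivation in each argument and vanishes on m^2, so gamma' can be computed on
   the classes of hbar y, where it takes the values of gamma. *)

(** * Power series and their limits *)

(** Why the two exponentials agree: on U' each factor chi carries hbar^2, so hbar^(-n) chi^n becomes
    hbar^n chi'^n. The N-th polar partial sum loses its denominator hbar^N exactly, and it differs
    from sigma by hbar^N times a continuous form, whatever the arguments. This uniform rate is what
    allows a limit to be taken in convolution products of two partial sums, both in the cocycle
    identity and in orthogonality.

    The obstacle is that a tensor is known only as a functional on admissible forms. Sweedler sums
    cannot be rearranged on elements, and a nested sum makes sense only once the inner one is known
    to be admissible again. The algebra is therefore done on F, where a continuous bilinear form is,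
    modulo hbar^N, a finite combination of products of two coordinates, so that each law reduces to
    one about linear forms on a single copy of F. Convolutions on U are compared with those on F
    along [dd_in]. *)

Section PowerSeries.
Variable k : comNzRingType.
Implicit Types (a b c : fps k) (N n : nat).

Lemma fps_coefD a b n : (a + b) n = a n + b n. Proof. by []. Qed.
Lemma fps_coefN a n : (- a) n = - a n. Proof. by []. Qed.
Lemma fps_coef1 n : (1 : fps k) n = (n == 0%N)%:R.
Proof. by rewrite /GRing.one /=; case: eqP. Qed.

Lemma fps_coef_sum I (r : seq I) (P : pred I) (f : I -> fps k) n :
  (\sum_(i <- r | P i) f i) n = \sum_(i <- r | P i) f i n.
Proof. by elim/big_rec2: _ => // i x y _ <-. Qed.

Lemma fps_coefM a b n : (a * b) n = \sum_(i < n.+1) a i * b (n - i)%N.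
Proof. by []. Qed.

Lemma fps_coefCM (x : k) a n : (fpsC x * a) n = x * a n.
Proof.
rewrite fps_coefM big_ord_recl /= subn0 big1 ?addr0 // => i _.
by rewrite mul0r.
Qed.

Lemma fps_coefXM a n : (hbar * a) n = if n is n'.+1 then a n' else 0.
Proof.
case: n => [|n]; first by rewrite fps_coefM big_ord1 /= mul0r.
rewrite fps_coefM big_ord_recl /= mul0r add0r big_ord_recl /= mul1r subn1 /=.
by rewrite big1 ?addr0 // => i _; rewrite mul0r.
Qed.

Lemma fps_coefXnM N a n :
  (hbar ^+ N * a) n = if (n < N)%N then 0 else a (n - N)%N.
Proof.
elim: N n => [|N IH] n; first by rewrite mul1r subn0.
by rewrite exprS -mulrA fps_coefXM; case: n => [|n] //; rewrite IH ltnS subSS.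
Qed.

Fact fpsC_is_additive : {morph @fpsC k : x y / x - y}.
Proof.
by move=> x y; apply: fpsP => n; rewrite fps_coefD fps_coefN /=;
  case: eqP; rewrite ?subr0.
Qed.
Fact fpsC_is_monoid_morphism : monoid_morphism (@fpsC k).
Proof.
split=> // x y; apply: fpsP => n; rewrite fps_coefCM /=.
by case: eqP; rewrite ?mulr0.
Qed.
HB.instance Definition _ :=
  GRing.isZmodMorphism.Build k (fps k) (@fpsC k) fpsC_is_additive.
HB.instance Definition _ :=
  GRing.isMonoidMorphism.Build k (fps k) (@fpsC k) fpsC_is_monoid_morphism.

Lemma hbarX_inj N : injective (fun a => hbar ^+ N * a).
Proof.
move=> a b /= ab; apply: fpsP => n.
have: (hbar ^+ N * a) (n + N)%N = (hbar ^+ N * b) (n + N)%N by rewrite ab.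
by rewrite !fps_coefXnM ltnNge leq_addl addnK.
Qed.

Definition fps_shift N a : fps k := Fps (fun n => a (n + N)%N).

Lemma hord_shift N a : hord N a -> a = hbar ^+ N * fps_shift N a.
Proof.
move=> aN; apply: fpsP => n; rewrite fps_coefXnM.
by case: ltnP => [/aN //|le_Nn]; rewrite /= subnK.
Qed.

Lemma hord_hbarX N a : hord N (hbar ^+ N * a).
Proof. by move=> n nN; rewrite fps_coefXnM nN. Qed.

Lemma hordP N a : hord N a <-> exists b, a = hbar ^+ N * b.
Proof.
split=> [/hord_shift aE | [b ->]]; last exact: hord_hbarX.
by exists (fps_shift N a).
Qed.

Lemma hordD N a b : hord N a -> hord N b -> hord N (a + b).
Proof. by move=> ha hb n nN; rewrite fps_coefD ha ?hb ?addr0. Qed.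

Lemma hordN N a : hord N a -> hord N (- a).
Proof. by move=> ha n nN; rewrite fps_coefN ha ?oppr0. Qed.

Lemma hordB N a b : hord N a -> hord N b -> hord N (a - b).
Proof. by move=> ha hb; apply/hordD/hordN. Qed.

Lemma hordMl N a b : hord N b -> hord N (a * b).
Proof. by move=> /hordP[c ->]; rewrite mulrCA; apply: hord_hbarX. Qed.

Lemma hordMr N a b : hord N a -> hord N (a * b).
Proof. by rewrite mulrC; apply: hordMl. Qed.

Lemma hordM N n a b : hord N a -> hord n b -> hord (N + n) (a * b).
Proof.
move=> /hordP[a' ->] /hordP[b' ->].
by rewrite mulrACA -exprD; apply: hord_hbarX.
Qed.

Lemma hordX N n a : hord N a -> hord (n * N) (a ^+ n).
Proof.
by move=> aN; elim: n => [|n IH] //; rewrite exprS mulSn; apply: hordM.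
Qed.

Lemma hord_sum N I (r : seq I) (P : pred I) (f : I -> fps k) :
  (forall i, P i -> hord N (f i)) -> hord N (\sum_(i <- r | P i) f i).
Proof. by move=> fN; elim/big_ind: _ => //; apply: hordD. Qed.

Lemma hord_le N n a : (n <= N)%N -> hord N a -> hord n a.
Proof. by move=> nN aN i /leq_trans /(_ nN); apply: aN. Qed.

Lemma hord_sub_trans N a b c : hord N (a - b) -> hord N (b - c) -> hord N (a - c).
Proof. by move=> ab bc; rewrite -(subrK b a) -addrA; apply: hordD. Qed.

Lemma hord_sub_sym N a b : hord N (a - b) -> hord N (b - a).
Proof. by move=> /hordN; rewrite opprB. Qed.

Lemma hord_cancel N n a : hord (N + n) (hbar ^+ N * a) -> hord n a.
Proof.
move=> ha i lt_in; have := ha (i + N)%N; rewrite addnC ltn_add2l => /(_ lt_in).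
by rewrite addnC fps_coefXnM ltnNge leq_addl addnK.
Qed.

Lemma fps_separated a b : (forall N, hord N (a - b)) -> a = b.
Proof.
move=> ab; apply: fpsP => n; apply/eqP; rewrite -subr_eq0; apply/eqP.
by rewrite -fps_coefN -fps_coefD (ab n.+1).
Qed.

Lemma hord_coef0 a b : hord 1 (a - b) -> a 0%N = b 0%N.
Proof. by move=> /(_ 0%N isT) /eqP; rewrite fps_coefD fps_coefN subr_eq0 => /eqP. Qed.

End PowerSeries.

(** * Limits in k((hbar)) versus limits in k[[hbar]] *)

Section Limits.
Variable k : comNzRingType.
Implicit Types (a b c : fps k) (u v : nat -> fps k) (l : laurent k).

Lemma hcvg_rate u a : (forall N, hord N (u N - a)) -> hcvg u a.
Proof. by move=> ua r; exists r => N rN; apply/(hord_le rN). Qed.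

Lemma polar_coefXM d n c i : polar_coef (d + n) (hbar ^+ n * c) i = polar_coef d c i.
Proof.
rewrite /polar_coef PoszD addrA; case: (i + d)%R => [m|m].
  by rewrite -PoszD fps_coefXnM ltnNge leq_addl addnK.
(* Here i + d is negative, so j < n lies below the order of hbar^n * c. *)
case E: (Negz m + n)%R => [j|//].
by rewrite fps_coefXnM ifT //; lia.
Qed.

Lemma polar_coef_hord (d N : nat) c (i : int) : hord N c -> i + d%:Z < N%:Z ->
  polar_coef d c i = 0.
Proof. by rewrite /polar_coef; case: (i + d)%R => // m cN mN; rewrite cN. Qed.

Lemma polar_coefB d a b i :
  polar_coef d (a - b) i = polar_coef d a i - polar_coef d b i.
Proof. by rewrite /polar_coef; case: (i + d)%R => // m; rewrite subr0. Qed.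

(** Once the numerators absorb the denominators hbar^(d N), nothing polar is left. The limits of
    polar partial sums are evaluated through this equivalence. *)
Lemma laurent_cvg_fps (d : nat -> nat) u v a :
  (forall N, u N = hbar ^+ d N * v N) ->
  laurent_cvg d u (fps_laurent a) <-> hcvg v a.
Proof.
move=> uv; split=> cv.
  move=> r; have [N0 cvN] := cv r%:Z; exists N0 => N /cvN {}cvN i ir.
  have H : v N i = a i.
    have := cvN i%:Z; rewrite uv -(add0n (d N)) polar_coefXM /= /polar_coef addr0.
    by apply; lia.
  by rewrite fps_coefD fps_coefN H subrr.
move=> r; have [N0 cvN] := cv `|r|%N; exists N0 => N /cvN {}cvN i ir /=.
rewrite uv -[d N]add0n polar_coefXM; apply/eqP; rewrite -subr_eq0 -polar_coefB.
by apply/eqP/(polar_coef_hord cvN); lia.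
Qed.

Lemma laurent_cvg_unique (d : nat -> nat) u l l' :
  laurent_cvg d u l -> laurent_cvg d u l' -> lcoef l =1 lcoef l'.
Proof.
move=> ul ul' i; have [[M lM] [N lN]] := (ul (i + 1), ul' (i + 1)).
have i1 : i < i + 1 by lia.
by rewrite -(lM _ (leq_maxl M N) i i1) (lN _ (leq_maxr M N) i i1).
Qed.

Lemma fps_laurent_inj a b :
  lcoef (fps_laurent a) =1 lcoef (fps_laurent b) -> a = b.
Proof. by move=> ab; apply: fpsP => n; have := ab n; rewrite /= /polar_coef addr0. Qed.

(** Multiplication by hbar^n only shifts exponents by n. This serves to pass from U' to elements
    that merely have an hbar-power multiple in U'. *)
Lemma laurent_cvgXM (d : nat -> nat) n u a :
  laurent_cvg d (fun N => hbar ^+ n * u N) (fps_laurent (hbar ^+ n * a)) ->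
  laurent_cvg d u (fps_laurent a).
Proof.
have shift e (c : fps k) (i : int) :
    polar_coef e (hbar ^+ n * c) (i + n%:Z) = polar_coef e c i.
  rewrite -[RHS](polar_coefXM e n) /polar_coef.
  by have -> : i + (e + n)%N%:Z = i + n%:Z + e%:Z by rewrite PoszD addrA addrAC.
move=> cv r; have [N0 cvN] := cv (r + n%:Z); exists N0 => N NN i ir /=.
by rewrite -shift cvN //; [apply: shift | lia].
Qed.

End Limits.

(** * Formal differentiation *)

Section Derivation.
Variable k : comNzRingType.
Implicit Types (a b : fps k) (n : nat).

Definition fps_deriv a : fps k := Fps (fun n => a n.+1 *+ n.+1).

Lemma fps_derivD a b : fps_deriv (a + b) = fps_deriv a + fps_deriv b.
Proof. by apply: fpsP => n; rewrite fps_coefD /= mulrnDl. Qed.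

Lemma fps_derivCM (x : k) a : fps_deriv (fpsC x * a) = fpsC x * fps_deriv a.
Proof.
apply: fpsP => n; rewrite -[LHS]/((fpsC x * a) n.+1 *+ n.+1) !fps_coefCM.
by rewrite -mulrnAr.
Qed.

Lemma fps_deriv0 : fps_deriv 0 = 0.
Proof. by apply: fpsP => n; rewrite /= mul0rn. Qed.

Lemma fps_deriv_sum I (r : seq I) (P : pred I) (f : I -> fps k) :
  fps_deriv (\sum_(i <- r | P i) f i) = \sum_(i <- r | P i) fps_deriv (f i).
Proof. exact: (big_morph _ fps_derivD fps_deriv0). Qed.

Lemma fps_derivM a b : fps_deriv (a * b) = fps_deriv a * b + a * fps_deriv b.
Proof.
apply: fpsP => n; rewrite fps_coefD.
(* Cutting at degree n+2 keeps the coefficient n+1, the last one that the n-th coefficient of a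
   derivative sees. The rule is then that of polynomials. *)
rewrite -[LHS]/((fps_mul a b) n.+1 *+ n.+1) (@fps_mul_trunc _ n.+2) // -coef_deriv.
have coefT c i : (i <= n.+1)%N -> (fps_trunc n.+2 c)`_i = c i.
  by move=> le_in; rewrite coef_poly ltnS le_in.
have derivT c i : (i <= n)%N -> (fps_trunc n.+2 c)^`()`_i = fps_deriv c i.
  by move=> le_in; rewrite coef_deriv coefT.
rewrite derivM coefD !coefM !fps_coefM; congr (_ + _); apply: eq_bigr => i _.
  by rewrite derivT ?coefT ?leq_subr // ?(leq_trans (leq_subr _ _)) // -ltnS.
by rewrite derivT ?coefT ?leq_subr // ltnW // ltnS -ltnS.
Qed.

Lemma fps_derivXn a n : fps_deriv (a ^+ n.+1) = n.+1%:R * (a ^+ n * fps_deriv a).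
Proof.
elim: n => [|n IH]; first by rewrite !mul1r.
rewrite exprS fps_derivM IH [n.+2%:R]mulrS; rewrite exprS; ring.
Qed.

End Derivation.

(** * The formal identities exp(-X) exp(X) = 1 and log(exp(X)) = X in characteristic 0 *)

Section ExpLog.
Variables (k : fieldType) (char0 : [pchar k] =i pred0).
Implicit Types (a : fps k) (n N : nat).

Lemma natr_neq0 n : n.+1%:R != 0 :> k.
Proof. by rewrite (proj1 (pcharf0P k) char0). Qed.

Lemma fact_neq0 n : n`!%:R != 0 :> k.
Proof. by rewrite -(prednK (fact_gt0 n)) natr_neq0. Qed.

Definition fps_exp : fps k := Fps (fun n => n`!%:R^-1).
Definition fps_expN : fps k := Fps (fun n => (-1) ^+ n * n`!%:R^-1).

(** Times n!, the n-th coefficient is the binomial expansion of (1 - 1)^n. *)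
Lemma fps_expN_exp : fps_expN * fps_exp = 1.
Proof.
apply: fpsP => n; rewrite fps_coefM fps_coef1.
apply: (mulfI (fact_neq0 n)); rewrite mulr_sumr.
transitivity ((1 - 1 : k) ^+ n); last first.
  by rewrite subrr expr0n; case: n => [|n]; rewrite ?mulr0 ?mulr1.
rewrite exprDn; apply: eq_bigr => i _; rewrite expr1n mul1r /=.
have le_in : (i <= n)%N by rewrite -ltnS.
rewrite -(bin_fact le_in) !natrM -mulr_natr.
rewrite mulrCA [(-1) ^+ i * _]mulrC; field.
by rewrite !fact_neq0.
Qed.

Lemma fps_deriv_exp : fps_deriv fps_exp = fps_exp.
Proof.
apply: fpsP => n /=; rewrite factS natrM -mulr_natr; field.
by rewrite fact_neq0 addrC natr1 natr_neq0.
Qed.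

Definition fps_log_trunc N a : fps k :=
  \sum_(1 <= n < N) fpsC ((-1) ^+ n.+1 / n%:R) * a ^+ n.

(* The derivative of the truncation is the geometric sum
   [1 - (1 - exp)^(N - 1)]. *)
Lemma fps_log_exp N : hord N (fps_log_trunc N (fps_exp - 1) - hbar).
Proof.
case: N => [|N]; first by [].
set Y := fps_exp - 1; set L := fps_log_trunc _ _.
have Y1 : hord 1 Y by case=> // _; rewrite fps_coefD fps_coefN /= fact0 invr1 subrr.
have DY : fps_deriv Y = 1 - (- Y).
  rewrite /Y fps_derivD.
  have -> : fps_deriv (- 1 : fps k) = 0 by apply: fpsP => n; rewrite /= oppr0 mul0rn.
  by rewrite addr0 fps_deriv_exp opprK addrC subrK.
have DL : fps_deriv L = 1 - (- Y) ^+ N.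
  rewrite /L /fps_log_trunc big_add1 big_mkord fps_deriv_sum.
  rewrite -[X in X - _](expr1n _ N) subrXX -DY mulr_sumr; apply: eq_bigr => i _.
  rewrite fps_derivCM fps_derivXn expr1n mul1r -(rmorph_nat (@fpsC k)).
  rewrite mulrA -rmorphM divfK ?natr_neq0 // !exprS !mulN1r opprK.
  by rewrite rmorphXn rmorphN1 mulrA -exprMn mulN1r mulrC.
have L0 : L 0%N = 0.
  rewrite /L /fps_log_trunc fps_coef_sum big_add1 big_mkord big1 // => i _.
  rewrite fps_coefCM (@hord_le _ i.+1 1) ?mulr0 //.
  by have := hordX (n := i.+1) Y1; rewrite muln1.
(* Away from the constant term, coefficient n+1 is recovered from the derivative on division by n+1,
   so order N of the derivative gives order N+1. *)
case=> [|n] nN; first by rewrite fps_coefD fps_coefN L0 subr0.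
apply: (mulIf (natr_neq0 n)); rewrite mul0r mulr_natr.
rewrite -[LHS]/(fps_deriv (L - hbar) n) fps_derivD DL.
have -> : fps_deriv (- hbar : fps k) = - 1.
  apply: fpsP => -[|m]; rewrite fps_coefN fps_coef1 /= ?oppr0 ?mul0rn //.
have YN : hord N ((- Y) ^+ N) by rewrite -[X in hord X _]muln1; apply/hordX/hordN.
by rewrite addrAC subrr add0r fps_coefN YN ?oppr0.
Qed.

End ExpLog.

(** * Continuous multilinear forms *)

Section Forms.
Variables (k : fieldType) (M : lmodType (fps k)).
Local Notation K := (fps k).
Implicit Types (l m n : M -> K) (b f : M -> M -> K) (x y z : M) (c : K).

Definition klinear l := forall c x y, l (c *: x + y) = c * l x + l y.

Definition bilin b := (forall z, klinear (b^~ z)) /\ (forall z, klinear (b z)).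

Lemma klinear0 l : klinear l -> l 0 = 0.
Proof. by move=> h; have := h (-1) 0 0; rewrite scaler0 addr0 mulN1r addNr. Qed.

Lemma klinearD l x y : klinear l -> l (x + y) = l x + l y.
Proof. by move=> h; have := h 1 x y; rewrite scale1r mul1r. Qed.

Lemma klinearZ l c x : klinear l -> l (c *: x) = c * l x.
Proof. by move=> h; have := h c x 0; rewrite (klinear0 h) !addr0. Qed.

Lemma klinearN l x : klinear l -> l (- x) = - l x.
Proof. by move=> h; rewrite -scaleN1r (klinearZ _ _ h) mulN1r. Qed.

Lemma klinearB l x y : klinear l -> l (x - y) = l x - l y.
Proof. by move=> h; rewrite (klinearD _ _ h) klinearN. Qed.

Lemma klinear_sum l I (r : seq I) (P : pred I) (v : I -> M) : klinear l ->
  l (\sum_(i <- r | P i) v i) = \sum_(i <- r | P i) l (v i).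
Proof.
move=> h; apply: (big_morph l _ (klinear0 h)) => x y; exact: klinearD.
Qed.

Lemma bilinDB b x x' y y' : bilin b ->
  b x' y' - b x y = b (x' - x) y' + b x (y' - y).
Proof.
move=> [bl br]; rewrite (klinearB _ _ (bl y')) (klinearB _ _ (br x)).
by rewrite addrA subrK.
Qed.

Lemma mlin1P l : mlin 1 (fun s => l s`_0) <-> klinear l.
Proof.
by split=> [h c x y | h [|? ?] [|? ?] c x y //=]; exact: (h [::] [::]).
Qed.

Lemma mlin2P b : mlin 2 (fun s => b s`_0 s`_1) <-> bilin b.
Proof.
split=> [h | [bl br]].
  by split=> z c x y; [exact: (h [::] [:: z]) | exact: (h [:: z] [::])].
by move=> [|s [|? ?]] [|t [|? ?]] c x y //= E;
  solve [lia | exact: bl | exact: br].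
Qed.

Lemma mlin3_rank1 l m n : klinear l -> klinear m -> klinear n ->
  mlin 3 (fun s => l s`_0 * m s`_1 * n s`_2).
Proof.
move=> hl hm hn [|s [|? [|? ?]]] [|t [|? [|? ?]]] c x y //= E;
  solve [lia | rewrite ?hl ?hm ?hn; ring].
Qed.

Lemma bilin_rank1 l m : klinear l -> klinear m -> bilin (fun x y => l x * m y).
Proof.
by move=> hl hm; split=> z c x y; rewrite ?hl ?hm ?mulrDl ?mulrDr ?mulrA //;
  rewrite [l z * c]mulrC.
Qed.

Lemma bilin_lin c f b : bilin f -> bilin b -> bilin (fun x y => c * f x y + b x y).
Proof.
by move=> [fl fr] [bl br]; split=> z d x y; rewrite ?fl ?bl ?fr ?br; ring.
Qed.

Lemma bilin0 : bilin (fun _ _ => 0).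
Proof. by split=> z c x y; rewrite mulr0 addr0. Qed.

Lemma bilin_div N f r : bilin f -> (forall x y, f x y = hbar ^+ N * r x y) -> bilin r.
Proof.
move=> [fl fr] E; split=> z c x y; apply: (@hbarX_inj _ N) => /=; rewrite -E.
  by rewrite fl !E; ring.
by rewrite fr !E; ring.
Qed.

(** Linearity is relative to a class P because a tensor is constrained only by its values on
    admissible forms: [bilin] for U, [cform2] for F. *)
Definition lin_on (P : (M -> M -> K) -> Prop) (T : (M -> M -> K) -> K) :=
  forall c a b, P a -> P b -> T (fun x y => c * a x y + b x y) = c * T a + T b.

Definition lin_closed (P : (M -> M -> K) -> Prop) :=
  P (fun _ _ => 0) /\
  forall c a b, P a -> P b -> P (fun x y => c * a x y + b x y).

Section LinOn.
Variables (P : (M -> M -> K) -> Prop) (PL : lin_closed P).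

Lemma lin_closedZ c f : P f -> P (fun x y => c * f x y).
Proof.
case: PL => P0 PD Pf; have := PD c _ _ Pf P0; congr P.
by apply/funext => x; apply/funext => y; rewrite addr0.
Qed.

Lemma lin_closedD f b : P f -> P b -> P (fun x y => f x y + b x y).
Proof.
case: PL => P0 PD Pf Pb; have := PD 1 _ _ Pf Pb; congr P.
by apply/funext => x; apply/funext => y; rewrite mul1r.
Qed.

Lemma lin_closed_sum I (r : seq I) (f : I -> M -> M -> K) : (forall i, P (f i)) ->
  P (fun x y => \sum_(i <- r) f i x y).
Proof.
move=> Pf; elim: r => [|i r IH].
  have := PL.1; congr P.
  by apply/funext => x; apply/funext => y; rewrite big_nil.
have := lin_closedD (Pf i) IH; congr P.
by apply/funext => x; apply/funext => y; rewrite big_cons.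
Qed.

Variables (T : (M -> M -> K) -> K) (TL : lin_on P T).

Lemma lin_on0 : T (fun _ _ => 0) = 0.
Proof.
rewrite -[RHS](addNr (T (fun _ _ => 0))) -mulN1r -(TL _ PL.1 PL.1); congr T.
by apply/funext => x; apply/funext => y; rewrite mulr0 addr0.
Qed.

Lemma lin_onZ c f : P f -> T (fun x y => c * f x y) = c * T f.
Proof.
move=> Pf; have := TL c Pf PL.1; rewrite lin_on0 addr0 => <-; congr T.
by apply/funext => x; apply/funext => y; rewrite addr0.
Qed.

Lemma lin_onD f b : P f -> P b -> T (fun x y => f x y + b x y) = T f + T b.
Proof.
move=> Pf Pb; have := TL 1 Pf Pb; rewrite mul1r => <-; congr T.
by apply/funext => x; apply/funext => y; rewrite mul1r.
Qed.

Lemma lin_on_sum I (r : seq I) (f : I -> M -> M -> K) : (forall i, P (f i)) ->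
  T (fun x y => \sum_(i <- r) f i x y) = \sum_(i <- r) T (f i).
Proof.
move=> Pf; elim: r => [|i r IH].
  rewrite big_nil -[RHS]lin_on0; congr T.
  by apply/funext => x; apply/funext => y; rewrite big_nil.
rewrite big_cons -IH -lin_onD //; last exact: lin_closed_sum.
by congr T; apply/funext => x; apply/funext => y; rewrite big_cons.
Qed.

End LinOn.

(** Modulo each hbar^N the tensor is a finite sum of evaluations, each of them linear in the
    form. *)
Lemma ctens2_lin t : ctens2 t -> lin_on bilin t.
Proof.
move=> ht c a b ha hb; apply: fps_separated => N.
have [L [Lsz hL]] := ht N.
pose app (f : M -> M -> K) := \sum_(p <- L) p.1 * f p.2`_0 p.2`_1.
have approx f : bilin f -> hord N (t f - app f).
  by move=> /mlin2P /hL.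
have -> : t (fun x y => c * a x y + b x y) - (c * t a + t b) =
    (t (fun x y => c * a x y + b x y) - app (fun x y => c * a x y + b x y)) -
    (c * (t a - app a) + (t b - app b)).
  have -> : app (fun x y => c * a x y + b x y) = c * app a + app b.
    rewrite /app mulr_sumr -big_split /=; apply: eq_bigr => p _; ring.
  ring.
apply: hordB; first exact/approx/bilin_lin.
by apply: hordD; [apply/hordMl/approx | apply: approx].
Qed.

End Forms.

(** * Continuous bilinear forms for the weak topology of K^E *)

Section WeakForms.
Variables (k : fieldType) (M : lmodType (fps k)) (E : eqType).
Variables (coord : M -> E -> fps k) (weak : weak_coord coord).
Local Notation K := (fps k).
Implicit Types (l m n : M -> K) (b f : M -> M -> K) (x y z : M) (c : K).
Implicit Types (S : seq E) (N d : nat).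

Lemma coord_klinear e : klinear (coord^~ e).
Proof. by move=> c x y; apply: weak.2. Qed.

Lemma wnbhs0W S S' d d' x : {subset S <= S'} -> (d <= d')%N ->
  wnbhs0 coord S' d' x -> wnbhs0 coord S d x.
Proof. by move=> SS dd h e /SS /h; apply: hord_le. Qed.

Lemma wnbhs0_catl S S' d d' x :
  wnbhs0 coord (S ++ S') (maxn d d') x -> wnbhs0 coord S d x.
Proof. by apply/wnbhs0W/leq_maxl => e eS; rewrite mem_cat eS. Qed.

Lemma wnbhs0_catr S S' d d' x :
  wnbhs0 coord (S ++ S') (maxn d d') x -> wnbhs0 coord S' d' x.
Proof. by apply/wnbhs0W/leq_maxr => e eS; rewrite mem_cat eS orbT. Qed.

Lemma wnbhs00 S d : wnbhs0 coord S d 0.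
Proof. by move=> e _; rewrite (klinear0 (coord_klinear e)). Qed.

Definition cont1 l := forall N, exists S d, forall x,
  wnbhs0 coord S d x -> hord N (l x).

(** Only one argument is small, and the neighbourhood is uniform in the other; this is what survives
    an inner Sweedler sum. *)
Definition cont2 b := forall N, exists S d, forall x y,
  wnbhs0 coord S d x -> hord N (b x y) /\ hord N (b y x).

Lemma wbasis : exists v : E -> M, forall i e, coord (v i) e = (e == i)%:R.
Proof.
case: weak => -[h _ hK] _; exists (fun i => h (fun e => (e == i)%:R)) => i e.
by rewrite hK.
Qed.

Lemma wtrunc_coord (v : E -> M) S x : (forall i e, coord (v i) e = (e == i)%:R) ->
  forall d, wnbhs0 coord S d (x - \sum_(i <- undup S) coord x i *: v i).
Proof.
move=> vE d e eS; rewrite (klinearB _ _ (coord_klinear e)).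
rewrite (klinear_sum _ _ _ (coord_klinear e)).
rewrite (bigD1_seq e) ?undup_uniq ?mem_undup //= (klinearZ _ _ (coord_klinear e)).
rewrite vE eqxx mulr1 big1 ?addr0 ?subrr // => i ie.
by rewrite (klinearZ _ _ (coord_klinear e)) vE eq_sym (negbTE ie) mulr0.
Qed.

Lemma cmlin1P l : cmlin coord 1 (fun s => l s`_0) <-> klinear l /\ cont1 l.
Proof.
split=> [[/mlin1P hl hc] | [hl hc]]; split=> //; last 2 first.
- exact/mlin1P.
- move=> s N _; have [S [d Sd]] := hc N; exists S, d => s' _ /(_ 0%N isT) /Sd.
  by rewrite klinearB.
move=> N; have [S [d Sd]] := hc [:: 0] N erefl; exists S, d => x xS.
have := Sd [:: x] erefl; rewrite /= (klinear0 hl) subr0; apply.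
by case=> // _; rewrite subr0.
Qed.

(** The point is uniformity in the second argument. Continuity at the origin settles small y; a
    general y is small up to a combination of the finitely many basis vectors indexed by [S0], and
    for these continuity in one variable provides a common neighbourhood. *)
Lemma cmlin2P b : cmlin coord 2 (fun s => b s`_0 s`_1) <-> bilin b /\ cont2 b.
Proof.
split=> [[/mlin2P hb hc] | [hb hc]]; split=> //; last 2 first.
- exact/mlin2P.
- move=> [|x [|y [|? ?]]] // N _; have [S [d Sd]] := hc N.
  exists S, d => -[|x' [|y' [|? ?]]] // _ h /=.
  rewrite bilinDB //; apply: hordD.
    by have [] := Sd _ y' (h 0%N isT).
  by have [] := Sd _ x (h 1%N isT).
have [bl br] := hb.
have sep N z : exists S d, forall x, wnbhs0 coord S d x ->
    hord N (b x z) /\ hord N (b z x).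
  have [S1 [d1 h1]] := hc [:: 0; z] N erefl.
  have [S2 [d2 h2]] := hc [:: z; 0] N erefl.
  exists (S1 ++ S2), (maxn d1 d2) => x xS; split.
    have := h1 [:: x; z] erefl; rewrite /= (klinear0 (bl z)) subr0; apply.
    case=> [|[|?]] // _; rewrite /= ?subr0 ?subrr; last exact: wnbhs00.
    exact: wnbhs0_catl xS.
  have := h2 [:: z; x] erefl; rewrite /= (klinear0 (br z)) subr0; apply.
  case=> [|[|?]] // _; rewrite /= ?subr0 ?subrr; first exact: wnbhs00.
  exact: wnbhs0_catr xS.
move=> N; have [S0 [d0 h0]] := hc [:: 0; 0] N erefl.
have small x y : wnbhs0 coord S0 d0 x -> wnbhs0 coord S0 d0 y -> hord N (b x y).
  move=> xS yS; have := h0 [:: x; y] erefl.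
  by rewrite /= (klinear0 (bl 0)) subr0; apply; case=> [|[|?]] // _; rewrite /= subr0.
have [v vE] := wbasis.
have [S1 [d1 h1]] : exists S d, forall i, i \in S0 -> forall x,
    wnbhs0 coord S d x -> hord N (b x (v i)) /\ hord N (b (v i) x).
  elim: (S0) => [|i S [S1 [d1 h1]]]; first by exists [::], 0%N.
  have [S2 [d2 h2]] := sep N (v i).
  exists (S2 ++ S1), (maxn d2 d1) => j; rewrite inE => /predU1P[-> x xS | jS x xS].
    exact/h2/(wnbhs0_catl xS).
  exact/h1/(wnbhs0_catr xS).
exists (S0 ++ S1), (maxn d0 d1) => x y xS.
have [xS0 xS1] := (wnbhs0_catl xS, wnbhs0_catr xS).
set Py := \sum_(i <- undup S0) coord y i *: v i.
have yP : wnbhs0 coord S0 d0 (y - Py) by apply: wtrunc_coord.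
rewrite -(subrK Py y); split.
  rewrite (klinearD _ _ (br x)); apply: hordD; first exact: small.
  rewrite /Py (klinear_sum _ _ _ (br x)) big_seq; apply: hord_sum => i.
  rewrite mem_undup => iS; rewrite (klinearZ _ _ (br x)).
  by apply: hordMl; have [] := h1 i iS x xS1.
rewrite (klinearD _ _ (bl x)); apply: hordD; first exact: small.
rewrite /Py (klinear_sum _ _ _ (bl x)) big_seq; apply: hord_sum => i.
rewrite mem_undup => iS; rewrite (klinearZ _ _ (bl x)).
by apply: hordMl; have [] := h1 i iS x xS1.
Qed.

Definition cform1 l := klinear l /\ cont1 l.
Definition cform2 b := bilin b /\ cont2 b.

Lemma coord_cform1 e : cform1 (coord^~ e).
Proof.
split; first exact: coord_klinear.
by move=> N; exists [:: e], N => x; apply; rewrite inE.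
Qed.

Lemma cform2_rank1 l m : cform1 l -> cform1 m -> cform2 (fun x y => l x * m y).
Proof.
move=> [hl cl] [hm cm]; split; first exact: bilin_rank1.
move=> N; have [S1 [d1 h1]] := cl N; have [S2 [d2 h2]] := cm N.
exists (S1 ++ S2), (maxn d1 d2) => x y xS; split.
  exact/hordMr/h1/(wnbhs0_catl xS).
exact/hordMl/h2/(wnbhs0_catr xS).
Qed.

Lemma cmlin3_rank1 l m n : cform1 l -> cform1 m -> cform1 n ->
  cmlin coord 3 (fun s => l s`_0 * m s`_1 * n s`_2).
Proof.
move=> [hl cl] [hm cm] [hn cn]; split; first exact: mlin3_rank1.
move=> [|x [|y [|z [|? ?]]]] // N _.
have [S1 [d1 h1]] := cl N; have [S2 [d2 h2]] := cm N; have [S3 [d3 h3]] := cn N.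
exists (S1 ++ (S2 ++ S3)), (maxn d1 (maxn d2 d3)).
case=> [|x' [|y' [|z' [|? ?]]]] // _ h.
have hx := h1 _ (wnbhs0_catl (h 0%N isT)).
have hy := h2 _ (wnbhs0_catl (wnbhs0_catr (h 1%N isT))).
have hz := h3 _ (wnbhs0_catr (wnbhs0_catr (h 2%N isT))).
rewrite /= in hx hy hz *.
rewrite (klinearB _ _ hl) in hx; rewrite (klinearB _ _ hm) in hy.
rewrite (klinearB _ _ hn) in hz.
have -> : l x' * m y' * n z' - l x * m y * n z =
    (l x' - l x) * (m y' * n z') + (m y' - m y) * (l x * n z') +
    (n z' - n z) * (l x * m y) by ring.
by apply: hordD; [apply: hordD|]; apply: hordMr.
Qed.

Lemma cform2_lin_closed : lin_closed cform2.
Proof.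
split; first by split; [exact: bilin0 | move=> N; exists [::], 0%N].
move=> c f b [hf cf] [hb cb]; split; first exact: bilin_lin.
move=> N; have [S1 [d1 h1]] := cf N; have [S2 [d2 h2]] := cb N.
exists (S1 ++ S2), (maxn d1 d2) => x y xS.
have [f1 f2] := h1 x y (wnbhs0_catl xS); have [b1 b2] := h2 x y (wnbhs0_catr xS).
by split; apply: hordD => //; apply: hordMl.
Qed.

Lemma cform2_div N f r : cform2 f -> (forall x y, f x y = hbar ^+ N * r x y) ->
  cform2 r.
Proof.
move=> [hf cf] fE; split; first exact: bilin_div fE.
move=> d; have [S [e h]] := cf (N + d)%N; exists S, e => x y /(h x y).
by rewrite !fE => -[/hord_cancel ? /hord_cancel].
Qed.

Lemma cform2_hord N f : cform2 f -> (forall x y, hord N (f x y)) ->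
  exists2 r, cform2 r & f = fun x y => hbar ^+ N * r x y.
Proof.
move=> hf fN; pose r x y := fps_shift N (f x y).
have fE x y : f x y = hbar ^+ N * r x y by apply/hord_shift/fN.
exists r; first exact: cform2_div fE.
by apply/funext => x; apply/funext => y.
Qed.

Lemma cform2_limit f :
  (forall N, exists2 b, cform2 b & forall x y, hord N (f x y - b x y)) -> cform2 f.
Proof.
move=> lim; split; last first.
  move=> N; have [b [_ cb] fb] := lim N.
  have [S [d h]] := cb N; exists S, d => x y /(h x y)[b1 b2].
  by rewrite -(subrK (b x y) (f x y)) -(subrK (b y x) (f y x)); split; apply: hordD.
split=> z c x y; apply: fps_separated => N; have [b [[bl br] _] fb] := lim N.
  have -> : f (c *: x + y) z - (c * f x z + f y z) =
      (f (c *: x + y) z - b (c *: x + y) z) - c * (f x z - b x z) - (f y z - b y z).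
    by rewrite bl; ring.
  by apply/hordB/fb/hordB/hordMl/fb/fb.
have -> : f z (c *: x + y) - (c * f z x + f z y) =
    (f z (c *: x + y) - b z (c *: x + y)) - c * (f z x - b z x) - (f z y - b z y).
  by rewrite br; ring.
by apply/hordB/fb/hordB/hordMl/fb/fb.
Qed.

Lemma cform2_partial_l f z : cform2 f -> cform1 (f^~ z).
Proof.
move=> [[fl fr] cf]; split=> // N; have [S [d h]] := cf N.
by exists S, d => x /(h x z)[].
Qed.

Lemma cform2_partial_r f z : cform2 f -> cform1 (f z).
Proof.
move=> [[fl fr] cf]; split=> // N; have [S [d h]] := cf N.
by exists S, d => x /(h x z)[].
Qed.

Lemma cform2_flip f : cform2 f -> cform2 (fun x y => f y x).
Proof.
move=> [[fl fr] cf]; split=> // N; have [S [d h]] := cf N.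
by exists S, d => x y /(h x y)[].
Qed.

(** Truncating both arguments to the coordinates in S changes f by a multiple of hbar^N, so the
    coefficients are the values of f on pairs of basis vectors. *)
Lemma cform2_approx f N : cform2 f -> exists S (c : E -> E -> K), forall x y,
  hord N (f x y - \sum_(i <- S) \sum_(j <- S) c i j * (coord x i * coord y j)).
Proof.
move=> [hf cf]; have [S [d h]] := cf N; have [v vE] := wbasis.
exists (undup S), (fun i j => f (v i) (v j)) => x y.
pose P z := \sum_(i <- undup S) coord z i *: v i.
have PS z : wnbhs0 coord S d (z - P z) by apply: wtrunc_coord.
have -> : \sum_(i <- undup S) \sum_(j <- undup S)
    f (v i) (v j) * (coord x i * coord y j) = f (P x) (P y).
  rewrite (klinear_sum _ _ _ (hf.1 (P y))); apply: eq_bigr => i _.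
  rewrite (klinearZ _ _ (hf.1 (P y))) (klinear_sum _ _ _ (hf.2 (v i))) mulr_sumr.
  apply: eq_bigr => j _; rewrite (klinearZ _ _ (hf.2 (v i))); ring.
rewrite bilinDB //.
by apply: hordD; [have [] := h _ y (PS x) | have [] := h _ (P x) (PS y)].
Qed.

Lemma coord_rank1_cform2 i j : cform2 (fun x y => coord x i * coord y j).
Proof. by apply: cform2_rank1; apply: coord_cform1. Qed.

(** The error is hbar^N times a form that is again continuous, so linearity of T alone bounds its
    image; no continuity of T enters. *)
Lemma lin_on_approx T f N S (c : E -> E -> K) : lin_on cform2 T -> cform2 f ->
  (forall x y,
    hord N (f x y - \sum_(i <- S) \sum_(j <- S) c i j * (coord x i * coord y j))) ->
  hord N (T f - \sum_(i <- S) \sum_(j <- S)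
     c i j * T (fun x y => coord x i * coord y j)).
Proof.
move=> TL hf happ.
pose f0 x y := \sum_(i <- S) \sum_(j <- S) c i j * (coord x i * coord y j).
have PL := cform2_lin_closed.
have hij i j : cform2 (fun x y => c i j * (coord x i * coord y j)).
  exact/(lin_closedZ PL)/coord_rank1_cform2.
have hi i : cform2 (fun x y => \sum_(j <- S) c i j * (coord x i * coord y j)).
  exact: (lin_closed_sum PL).
have hf0 : cform2 f0 by apply: (lin_closed_sum PL).
have -> : \sum_(i <- S) \sum_(j <- S) c i j * T (fun x y => coord x i * coord y j)
    = T f0.
  rewrite /f0 (lin_on_sum PL TL) //; apply: eq_bigr => i _.
  rewrite (lin_on_sum PL TL) //; apply: eq_bigr => j _.
  by rewrite (lin_onZ PL TL) //; apply: coord_rank1_cform2.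
have hd : cform2 (fun x y => f x y - f0 x y).
  have := PL.2 (-1) _ _ hf0 hf; congr cform2.
  by apply/funext => x; apply/funext => y; rewrite mulN1r addrC.
have [r hr fE] := cform2_hord hd happ.
have -> : f = fun x y => hbar ^+ N * r x y + f0 x y.
  apply/funext => x; apply/funext => y.
  by rewrite -[_ * _](congr1 (fun h => h x y) fE) subrK.
by rewrite TL // addrK; apply: hord_hbarX.
Qed.

(* Continuous bilinear forms are, modulo each power of hbar, finite sums of rank
   one forms, so a linear functional is determined by its values on the latter. *)
Lemma lin_on_rank1_eq T1 T2 f : lin_on cform2 T1 -> lin_on cform2 T2 ->
  (forall l m, cform1 l -> cform1 m ->
    T1 (fun x y => l x * m y) = T2 (fun x y => l x * m y)) ->
  cform2 f -> T1 f = T2 f.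
Proof.
move=> T1L T2L T12 hf; apply: fps_separated => N.
have [S [c hc]] := cform2_approx N hf.
have h1 := lin_on_approx T1L hf hc; have h2 := lin_on_approx T2L hf hc.
apply: hord_sub_trans h1 _; apply: hord_sub_sym.
rewrite [X in _ - X](_ : _ = \sum_(i <- S) \sum_(j <- S)
     c i j * T2 (fun x y => coord x i * coord y j)) //.
by apply: eq_bigr => i _; apply: eq_bigr => j _; rewrite T12 //; apply: coord_cform1.
Qed.

End WeakForms.

(** * The convolution algebra of a QFSHA *)

Section Convolution.
Variables (k : fieldType) (F : QFSHA k).
Local Notation K := (fps k).
Local Notation O := (qf_ops F).
Local Notation coord := (qf_coord (q := F)).
Local Notation weak := (qf_weak F).
Local Notation cf1 := (cform1 coord).
Local Notation cf2 := (cform2 coord).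
Local Notation PL := (cform2_lin_closed coord).
Implicit Types (a b x y : F) (l m n : F -> K) (f g h : F -> F -> K) (c : K).

Lemma form1P l : form1 (cmlin coord) l <-> cf1 l.
Proof. exact: cmlin1P. Qed.

Lemma form2P f : form2 (cmlin coord) f <-> cf2 f.
Proof. exact: (cmlin2P weak). Qed.

Lemma qf_cop_lin a : lin_on cf2 (cop O a).
Proof. by move=> c f g /form2P hf /form2P hg; apply: (hopf_cop_tens (qf_hopf F)). Qed.

Lemma qf_cop_cform1 f : cf2 f -> cf1 (fun a => cop O a f).
Proof. by move=> /form2P hf; apply/form1P/(hopf_cop_cont (qf_hopf F)). Qed.

Lemma eps_cform1 : cf1 (eps O).
Proof. exact/form1P/(hopf_eps_cont (qf_hopf F)). Qed.

(** By [cont2], a small outer argument makes the integrand divisible by hbar^N for all inner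
    arguments, and the quotient is still a continuous form. *)
Lemma cop_inner_cform2 f g b : cf2 f -> cf2 g ->
  cf2 (fun a1 a2 => cop O b (fun b1 b2 => f a1 b1 * g a2 b2)).
Proof.
move=> hf hg.
have inner x y : cf2 (fun b1 b2 => f x b1 * g y b2).
  by apply: cform2_rank1; apply: cform2_partial_r.
split; first split=> z c x y.
- rewrite -(qf_cop_lin b c (inner x z) (inner y z)); congr cop.
  by apply/funext => s; apply/funext => t; rewrite (hf.1.1 s); ring.
- rewrite -(qf_cop_lin b c (inner z x) (inner z y)); congr cop.
  by apply/funext => s; apply/funext => t; rewrite (hg.1.1 t); ring.
move=> N; have [S1 [d1 h1]] := hf.2 N; have [S2 [d2 h2]] := hg.2 N.
exists (S1 ++ S2), (maxn d1 d2) => x y xS.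
have small u v : (forall s t, hord N (f u s * g v t)) ->
    hord N (cop O b (fun s t => f u s * g v t)).
  move=> uv; have [r hr ->] := cform2_hord (inner u v) uv.
  by rewrite (lin_onZ PL (@qf_cop_lin b)) //; apply: hord_hbarX.
split; apply: small => s t.
  by apply: hordMr; have [] := h1 x s (wnbhs0_catl xS).
by apply: hordMl; have [] := h2 x t (wnbhs0_catr xS).
Qed.

Lemma conv_linl g a b : cf2 g -> lin_on cf2 (fun f => conv O f g a b).
Proof.
move=> hg c f1 f2 h1 h2.
rewrite -[RHS](qf_cop_lin a) /conv; try exact: cop_inner_cform2.
congr cop; apply/funext => x; apply/funext => y; rewrite -[RHS](qf_cop_lin b).
- by congr cop; apply/funext => s; apply/funext => t; ring.
all: by apply: cform2_rank1; apply: cform2_partial_r.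
Qed.

Lemma conv_linr f a b : cf2 f -> lin_on cf2 (fun g => conv O f g a b).
Proof.
move=> hf c f1 f2 h1 h2.
rewrite -[RHS](qf_cop_lin a) /conv; try exact: cop_inner_cform2.
congr cop; apply/funext => x; apply/funext => y; rewrite -[RHS](qf_cop_lin b).
- by congr cop; apply/funext => s; apply/funext => t; ring.
all: by apply: cform2_rank1; apply: cform2_partial_r.
Qed.

Definition conv_form l m : F -> K := fun a => cop O a (fun x y => l x * m y).

Lemma conv_form_cform1 l m : cf1 l -> cf1 m -> cf1 (conv_form l m).
Proof. by move=> hl hm; apply/qf_cop_cform1/cform2_rank1. Qed.

Lemma conv_formA l m n : cf1 l -> cf1 m -> cf1 n ->
  conv_form l (conv_form m n) = conv_form (conv_form l m) n.
Proof.
move=> hl hm hn; apply/funext => a.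
have E := hopf_coassoc (qf_hopf F) a
  (b := fun x y z => l x * m y * n z) (cmlin3_rank1 hl hm hn).
rewrite /conv_form.
transitivity (cop O a (fun x y => cop O y (fun y1 y2 => l x * m y1 * n y2))).
  congr cop; apply/funext => x; apply/funext => y.
  rewrite -(lin_onZ PL (@qf_cop_lin y)); last exact: cform2_rank1.
  by congr cop; apply/funext => s; apply/funext => t; ring.
rewrite E; congr cop; apply/funext => x; apply/funext => y.
rewrite mulrC -(lin_onZ PL (@qf_cop_lin x)); last exact: cform2_rank1.
by congr cop; apply/funext => s; apply/funext => t; ring.
Qed.

Lemma conv_form_epsl l : cf1 l -> conv_form (eps O) l = l.
Proof.
by move=> /form1P hl; apply/funext => a; apply: (hopf_counitl (qf_hopf F)).
Qed.

Lemma conv_form_epsr l : cf1 l -> conv_form l (eps O) = l.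
Proof.
by move=> /form1P hl; apply/funext => a; apply: (hopf_counitr (qf_hopf F)).
Qed.

(** The Sweedler sums of the two arguments separate. Through this the algebra laws reduce to
    coassociativity and the counit axioms. *)
Lemma conv_rank1 l l' m m' : cf1 l -> cf1 l' -> cf1 m -> cf1 m' ->
  conv O (fun x y => l x * l' y) (fun x y => m x * m' y) =
  fun x y => conv_form l m x * conv_form l' m' y.
Proof.
move=> hl hl' hm hm'; apply/funext => a; apply/funext => b.
rewrite /conv [RHS]mulrC -(lin_onZ PL (@qf_cop_lin a)); last exact: cform2_rank1.
congr cop; apply/funext => x; apply/funext => y.
rewrite mulrC -(lin_onZ PL (@qf_cop_lin b)); last exact: cform2_rank1.
by congr cop; apply/funext => s; apply/funext => t; ring.
Qed.

Lemma conv1_cform2 : cf2 (conv1 O).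
Proof. by apply: cform2_rank1; apply: eps_cform1. Qed.

(** Directly, the axioms give continuity in the first argument with the second one fixed. Joint
    continuity comes from approximating f, then g, by sums of rank one forms, uniformly in both
    arguments. *)
Lemma conv_cform2 f g : cf2 f -> cf2 g -> cf2 (conv O f g).
Proof.
suff conv_rank l m g' : cf1 l -> cf1 m -> cf2 g' ->
    cf2 (conv O (fun x y => l x * m y) g').
  move=> hf hg; apply: cform2_limit => N.
  have [S [c hc]] := cform2_approx weak N hf.
  exists (fun a b => \sum_(i <- S) \sum_(j <- S)
      c i j * conv O (fun x y => coord x i * coord y j) g a b).
    apply: (lin_closed_sum PL) => i; apply: (lin_closed_sum PL) => j.
    by apply/(lin_closedZ PL)/conv_rank => //; apply: (coord_cform1 weak).
  by move=> a b; apply: (lin_on_approx weak (@conv_linl g a b hg) hf hc).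
move=> hl hm hg; have hlm := cform2_rank1 hl hm.
apply: cform2_limit => N; have [S [c hc]] := cform2_approx weak N hg.
exists (fun a b => \sum_(i <- S) \sum_(j <- S)
    c i j * conv O (fun x y => l x * m y) (fun x y => coord x i * coord y j) a b).
  apply: (lin_closed_sum PL) => i; apply: (lin_closed_sum PL) => j.
  apply/(lin_closedZ PL); rewrite conv_rank1 //; try exact: (coord_cform1 weak).
  by apply: cform2_rank1; apply: conv_form_cform1 => //; apply: (coord_cform1 weak).
by move=> a b; apply: (lin_on_approx weak (@conv_linr _ a b hlm) hg hc).
Qed.

Lemma conv_linlE c f1 f2 g : cf2 f1 -> cf2 f2 -> cf2 g ->
  conv O (fun x y => c * f1 x y + f2 x y) g =
  fun a b => c * conv O f1 g a b + conv O f2 g a b.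
Proof.
by move=> h1 h2 hg; apply/funext => a; apply/funext => b; apply: conv_linl.
Qed.

Lemma conv_linrE c f g1 g2 : cf2 f -> cf2 g1 -> cf2 g2 ->
  conv O f (fun x y => c * g1 x y + g2 x y) =
  fun a b => c * conv O f g1 a b + conv O f g2 a b.
Proof.
by move=> hf h1 h2; apply/funext => a; apply/funext => b; apply: conv_linr.
Qed.

(* Both sides of each identity below are linear in every argument, hence it
   suffices to compare them on rank one forms. *)
Lemma convA f g h : cf2 f -> cf2 g -> cf2 h ->
  conv O f (conv O g h) = conv O (conv O f g) h.
Proof.
move=> hf hg hh; apply/funext => a; apply/funext => b.
pose T1 f g h := conv O f (conv O g h) a b.
pose T2 f g h := conv O (conv O f g) h a b.
apply: (lin_on_rank1_eq weak (T1 := fun f => T1 f g h) (T2 := fun f => T2 f g h)) hf.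
- exact/conv_linl/conv_cform2.
- move=> c u v hu hv; rewrite /T2 conv_linlE //.
  by apply: conv_linl => //; apply: conv_cform2.
move=> l l' hl hl'; have hll := cform2_rank1 hl hl'.
apply: (lin_on_rank1_eq weak (T1 := fun g => T1 _ g h) (T2 := fun g => T2 _ g h)) hg.
- move=> c u v hu hv; rewrite /T1 conv_linlE //.
  by apply: conv_linr => //; apply: conv_cform2.
- move=> c u v hu hv; rewrite /T2 conv_linrE //.
  by apply: conv_linl => //; apply: conv_cform2.
move=> m m' hm hm'; have hmm := cform2_rank1 hm hm'.
apply: (lin_on_rank1_eq weak (T1 := T1 _ _) (T2 := T2 _ _)) hh.
- move=> c u v hu hv; rewrite /T1 conv_linrE //.
  by apply: conv_linr => //; apply: conv_cform2.
- exact/conv_linr/conv_cform2.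
move=> n n' hn hn'.
by rewrite /T1 /T2 !conv_rank1 ?conv_formA //; apply: conv_form_cform1.
Qed.

Lemma conv1l f : cf2 f -> conv O (conv1 O) f = f.
Proof.
move=> hf; apply/funext => a; apply/funext => b.
apply: (lin_on_rank1_eq weak (T1 := fun f => conv O _ f a b)
  (T2 := fun f => f a b)) hf => //; first exact/conv_linr/conv1_cform2.
move=> l m hl hm; rewrite conv_rank1 ?conv_form_epsl //; exact: eps_cform1.
Qed.

Lemma conv1r f : cf2 f -> conv O f (conv1 O) = f.
Proof.
move=> hf; apply/funext => a; apply/funext => b.
apply: (lin_on_rank1_eq weak (T1 := fun f => conv O f _ a b)
  (T2 := fun f => f a b)) hf => //; first exact/conv_linl/conv1_cform2.
move=> l m hl hm; rewrite conv_rank1 ?conv_form_epsr //; exact: eps_cform1.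
Qed.

(** The two sides take the sums over a and b in opposite orders; this exchange is checked on rank
    one forms. *)
Lemma conv_flip f g : cf2 f -> cf2 g ->
  flip (conv O f g) = conv O (flip f) (flip g).
Proof.
move=> hf hg; apply/funext => a; apply/funext => b.
apply: (lin_on_rank1_eq weak (T1 := fun f => conv O f g b a)
  (T2 := fun f => conv O (flip f) (flip g) a b)) hf.
- exact: conv_linl.
- by move=> c u v hu hv; apply: conv_linl; apply: cform2_flip.
move=> l l' hl hl'; have hll := cform2_rank1 hl hl'.
apply: (lin_on_rank1_eq weak (T1 := fun g => conv O _ g b a)
  (T2 := fun g => conv O _ (flip g) a b)) hg.
- exact: conv_linr.
- move=> c u v hu hv; apply: conv_linr; exact: cform2_flip.
move=> m m' hm hm'; rewrite conv_rank1 //.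
transitivity (conv O (fun x y => l' x * l y) (fun x y => m' x * m y) a b).
  by rewrite conv_rank1 // mulrC.
by congr (conv O _ _ a b); apply/funext => x; apply/funext => y; rewrite /flip mulrC.
Qed.

End Convolution.

(** * The algebra of continuous bilinear forms under convolution, and its hbar-adic filtration *)

Record conv_alg (k : fieldType) (F : QFSHA k) := ConvAlg {
  conv_fun :> F -> F -> fps k;
  conv_funP : cform2 (qf_coord (q := F)) conv_fun }.

HB.instance Definition _ (k : fieldType) (F : QFSHA k) := gen_eqMixin (conv_alg F).
HB.instance Definition _ (k : fieldType) (F : QFSHA k) :=
  gen_choiceMixin (conv_alg F).

Lemma conv_algP (k : fieldType) (F : QFSHA k) (f g : conv_alg F) :
  (forall x y, f x y = g x y) -> f = g.
Proof.
case: f g => [f hf] [g hg] /= fg.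
have {}fg : f = g by apply/funext => x; apply/funext => y.
by subst g; congr ConvAlg; apply: Prop_irrelevance.
Qed.

Section ConvAlgebra.
Variables (k : fieldType) (F : QFSHA k).
Local Notation O := (qf_ops F).
Local Notation PL := (cform2_lin_closed (qf_coord (q := F))).
Implicit Types (f g h : conv_alg F) (c : fps k).

Definition ca_zero : conv_alg F := ConvAlg PL.1.
Definition ca_add f g : conv_alg F :=
  ConvAlg (lin_closedD PL (conv_funP f) (conv_funP g)).
Definition ca_scale c f : conv_alg F := ConvAlg (lin_closedZ PL c (conv_funP f)).
Definition ca_mul f g : conv_alg F :=
  ConvAlg (conv_cform2 (conv_funP f) (conv_funP g)).
Definition ca_one : conv_alg F := ConvAlg (conv1_cform2 F).

Fact ca_addA : associative ca_add.
Proof. by move=> f g h; apply: conv_algP => x y; apply: addrA. Qed.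
Fact ca_addC : commutative ca_add.
Proof. by move=> f g; apply: conv_algP => x y; apply: addrC. Qed.
Fact ca_add0 : left_id ca_zero ca_add.
Proof. by move=> f; apply: conv_algP => x y; apply: add0r. Qed.
Fact ca_addN : left_inverse ca_zero (ca_scale (-1)) ca_add.
Proof. by move=> f; apply: conv_algP => x y /=; rewrite mulN1r addNr. Qed.

HB.instance Definition _ :=
  GRing.isZmodule.Build (conv_alg F) ca_addA ca_addC ca_add0 ca_addN.

Fact ca_mulA : associative ca_mul.
Proof.
move=> f g h; apply: conv_algP => x y /=.
by rewrite convA //; apply: conv_funP.
Qed.
Fact ca_mul1l : left_id ca_one ca_mul.
Proof.
move=> f; apply: conv_algP => x y /=.
by rewrite conv1l //; apply: conv_funP.
Qed.
Fact ca_mul1r : right_id ca_one ca_mul.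
Proof.
move=> f; apply: conv_algP => x y /=.
by rewrite conv1r //; apply: conv_funP.
Qed.
Fact ca_mulDl : left_distributive ca_mul ca_add.
Proof.
move=> f g h; apply: conv_algP => x y.
exact: (lin_onD (conv_linl x y (conv_funP h)) (conv_funP f) (conv_funP g)).
Qed.
Fact ca_mulDr : right_distributive ca_mul ca_add.
Proof.
move=> f g h; apply: conv_algP => x y.
exact: (lin_onD (conv_linr x y (conv_funP f)) (conv_funP g) (conv_funP h)).
Qed.

Fact ca_one_neq0 : ca_one != 0.
Proof.
apply/eqP => /(congr1 (fun f : conv_alg F => f 1 1)) /= /eqP.
by rewrite /conv1 (hopf_eps1 (qf_hopf F)) mulr1 (oner_eq0 (fps k)).
Qed.

HB.instance Definition _ := GRing.Zmodule_isNzRing.Build (conv_alg F)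
  ca_mulA ca_mul1l ca_mul1r ca_mulDl ca_mulDr ca_one_neq0.

Fact ca_scaleA c d f : ca_scale c (ca_scale d f) = ca_scale (c * d) f.
Proof. by apply: conv_algP => x y; apply: mulrA. Qed.
Fact ca_scale1 : left_id 1 ca_scale.
Proof. by move=> f; apply: conv_algP => x y; apply: mul1r. Qed.
Fact ca_scaleDr : right_distributive ca_scale +%R.
Proof. by move=> c f g; apply: conv_algP => x y; apply: mulrDr. Qed.
Fact ca_scaleDl f : {morph ca_scale^~ f : c d / c + d}.
Proof. by move=> c d; apply: conv_algP => x y; apply: mulrDl. Qed.

HB.instance Definition _ := GRing.Zmodule_isLmodule.Build (fps k) (conv_alg F)
  ca_scaleA ca_scale1 ca_scaleDr ca_scaleDl.

Fact ca_scaleAl c f g : c *: (f * g) = (c *: f) * g.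
Proof.
apply: conv_algP => x y; apply/esym.
exact: (lin_onZ PL (conv_linl x y (conv_funP g)) c (conv_funP f)).
Qed.
Fact ca_scaleAr c f g : c *: (f * g) = f * (c *: g).
Proof.
apply: conv_algP => x y; apply/esym.
exact: (lin_onZ PL (conv_linr x y (conv_funP f)) c (conv_funP g)).
Qed.

HB.instance Definition _ :=
  GRing.Lmodule_isLalgebra.Build (fps k) (conv_alg F) ca_scaleAl.
HB.instance Definition _ :=
  GRing.Lalgebra_isAlgebra.Build (fps k) (conv_alg F) ca_scaleAr.

Lemma caD f g x y : (f + g) x y = f x y + g x y. Proof. by []. Qed.
Lemma caN f x y : (- f) x y = - f x y. Proof. exact: mulN1r. Qed.
Lemma caB f g x y : (f - g) x y = f x y - g x y. Proof. by rewrite caD caN. Qed.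
Lemma caZ c f x y : (c *: f) x y = c * f x y. Proof. by []. Qed.

Lemma ca_sum I (r : seq I) (P : pred I) (f : I -> conv_alg F) x y :
  (\sum_(i <- r | P i) f i) x y = \sum_(i <- r | P i) f i x y.
Proof. by elim/big_rec2: _ => // i u v _ <-. Qed.

Lemma conv_powE f n : conv_pow O f n = (f ^+ n : conv_alg F).
Proof.
elim: n => [|n IH] //.
by rewrite exprS /conv_pow iterS -/(conv_pow _ _ _) IH.
Qed.

Definition cord N f := exists r, f = hbar ^+ N *: r.

Lemma cord0 f : cord 0 f.
Proof. by exists f; rewrite scale1r. Qed.

Lemma cordP N f : cord N f <-> forall x y, hord N (f x y).
Proof.
split=> [[r ->] x y | fN]; first exact: hord_hbarX.
have [r hr fE] := cform2_hord (conv_funP f) fN.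
exists (ConvAlg hr); apply: conv_algP => x y; exact: (congr1 (fun u => u x y) fE).
Qed.

Lemma cordD N f g : cord N f -> cord N g -> cord N (f + g).
Proof. by move=> [r ->] [s ->]; exists (r + s); rewrite scalerDr. Qed.

Lemma cordN N f : cord N f -> cord N (- f).
Proof. by move=> [r ->]; exists (- r); rewrite scalerN. Qed.

Lemma cordMl N f g : cord N g -> cord N (f * g).
Proof. by move=> [r ->]; exists (f * r); rewrite scalerAr. Qed.

Lemma cordMr N f g : cord N f -> cord N (f * g).
Proof. by move=> [r ->]; exists (r * g); rewrite scalerAl. Qed.

Lemma cord_sub_trans N f g h : cord N (f - g) -> cord N (g - h) -> cord N (f - h).
Proof. by move=> fg gh; rewrite -(subrK g f) -addrA; apply: cordD. Qed.

Lemma cord_sub_sym N f g : cord N (f - g) -> cord N (g - f).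
Proof. by move=> /cordN; rewrite opprB. Qed.

Lemma ca_separated f g : (forall N, cord N (f - g)) -> f = g.
Proof.
move=> fg; apply: conv_algP => x y; apply: fps_separated => N.
by rewrite -caB; have /cordP := fg N; apply.
Qed.

Lemma ca_hbar_inj f g : hbar *: f = hbar *: g -> f = g.
Proof.
move=> fg; apply: conv_algP => x y; apply: (@hbarX_inj _ 1) => /=.
by rewrite expr1 -!caZ fg.
Qed.

Definition ca_flip f : conv_alg F := ConvAlg (cform2_flip (conv_funP f)).

Fact ca_flip_is_additive : {morph ca_flip : f g / f - g}.
Proof. by move=> f g; apply: conv_algP. Qed.
Fact ca_flip_is_monoid_morphism : monoid_morphism ca_flip.
Proof.
split=> [|f g]; apply: conv_algP => x y; first exact: mulrC.
have := conv_flip (conv_funP f) (conv_funP g).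
exact: (congr1 (fun u => u x y)).
Qed.

HB.instance Definition _ :=
  GRing.isZmodMorphism.Build (conv_alg F) (conv_alg F) ca_flip ca_flip_is_additive.
HB.instance Definition _ :=
  GRing.isMonoidMorphism.Build (conv_alg F) (conv_alg F) ca_flip
    ca_flip_is_monoid_morphism.

Lemma ca_flipZ c f : ca_flip (c *: f) = c *: ca_flip f.
Proof. exact: conv_algP. Qed.

End ConvAlgebra.

(** * Evaluation of power series at hbar chi *)

Section FunctionalCalculus.
Variables (k : fieldType) (F : QFSHA k).
Implicit Types (f g chi psi : conv_alg F) (a b c : fps k) (N n : nat).

Definition fcalc_part chi a N : conv_alg F :=
  \sum_(n < N) fpsC (a n) *: (hbar *: chi) ^+ n.

(** Terms of index above j are divisible by hbar^(j+1), so coefficient j of the limit can be read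
    off the partial sum with j+1 terms. *)
Definition fcalc_fun chi a : F -> F -> fps k :=
  fun x y => Fps (fun j => fcalc_part chi a j.+1 x y j).

Lemma fcalc_part_hord chi a x y N :
  hord N (fcalc_fun chi a x y - fcalc_part chi a N x y).
Proof.
move=> j jN; rewrite fps_coefD fps_coefN [X in X - _]/=.
have -> : fcalc_part chi a N = fcalc_part chi a j.+1 +
    \sum_(i < N - j.+1) fpsC (a (j.+1 + i)%N) *: (hbar *: chi) ^+ (j.+1 + i).
  by rewrite -{1}(subnKC jN) /fcalc_part big_split_ord.
rewrite caD fps_coefD opprD addrA subrr sub0r ca_sum fps_coef_sum.
rewrite big1 ?oppr0 // => i _.
have -> : fpsC (a (j.+1 + i)%N) *: (hbar *: chi) ^+ (j.+1 + i) =
    hbar ^+ j.+1 *: (fpsC (a (j.+1 + i)%N) *: (chi ^+ j.+1 * (hbar *: chi) ^+ i)).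
  by rewrite exprD exprZn -scalerAl !scalerA mulrC.
by rewrite caZ hord_hbarX.
Qed.

Fact fcalc_cform2 chi a : cform2 (qf_coord (q := F)) (fcalc_fun chi a).
Proof.
apply: cform2_limit => N; exists (fcalc_part chi a N); first exact: conv_funP.
by move=> x y; apply: fcalc_part_hord.
Qed.

(* [fcalc chi a] is the series a evaluated at [hbar *: chi]. *)
Definition fcalc chi a : conv_alg F := ConvAlg (fcalc_cform2 chi a).

Lemma fcalc_cord chi a N : cord N (fcalc chi a - fcalc_part chi a N).
Proof. by apply/cordP => x y; rewrite caB; apply: fcalc_part_hord. Qed.

Lemma fcalc_part_eq chi psi a b N : (forall n, (n < N)%N ->
    fpsC (a n) *: (hbar *: chi) ^+ n = fpsC (b n) *: (hbar *: psi) ^+ n) ->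
  fcalc_part chi a N = fcalc_part psi b N.
Proof. by move=> E; apply: eq_bigr => i _; apply: E. Qed.

Lemma fcalc_unique chi a f : (forall N, cord N (f - fcalc_part chi a N)) ->
  f = fcalc chi a.
Proof.
move=> fN; apply: ca_separated => N; apply: cord_sub_trans (fN N) _.
exact/cord_sub_sym/fcalc_cord.
Qed.

Fact fcalc_is_additive chi : {morph fcalc chi : a b / a - b}.
Proof.
move=> a b; apply/esym/fcalc_unique => N.
have -> : fcalc_part chi (a - b) N = fcalc_part chi a N - fcalc_part chi b N.
  rewrite -sumrB; apply: eq_bigr => n _.
  by rewrite fps_coefD fps_coefN rmorphB scalerBl.
have [[r Er] [t Et]] := (fcalc_cord chi a N, fcalc_cord chi b N).
by exists (r - t); rewrite scalerBr -Er -Et !opprD opprK addrACA.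
Qed.

HB.instance Definition _ chi :=
  GRing.isZmodMorphism.Build (fps k) (conv_alg F) (fcalc chi) (fcalc_is_additive chi).

Lemma fcalcCM chi (u : k) a : fcalc chi (fpsC u * a) = fpsC u *: fcalc chi a.
Proof.
apply/esym/fcalc_unique => N.
have -> : fcalc_part chi (fpsC u * a) N = fpsC u *: fcalc_part chi a N.
  by rewrite scaler_sumr; apply: eq_bigr => n _; rewrite fps_coefCM rmorphM scalerA.
have [r Er] := fcalc_cord chi a N; exists (fpsC u *: r).
by rewrite -scalerBr Er !scalerA mulrC.
Qed.

Lemma fcalcXM chi a : fcalc chi (hbar * a) = hbar *: chi * fcalc chi a.
Proof.
apply/esym/fcalc_unique => -[|N]; first exact: cord0.
have -> : fcalc_part chi (hbar * a) N.+1 = hbar *: chi * fcalc_part chi a N.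
  rewrite /fcalc_part big_ord_recl fps_coefXM rmorph0 scale0r add0r mulr_sumr.
  apply: eq_bigr => n _.
  by rewrite (fps_coefXM a n.+1) -scalerAr -exprS.
have [r Er] := fcalc_cord chi a N; exists (chi * r).
by rewrite -mulrBr Er -scalerAl -scalerAr scalerA -exprS.
Qed.

Lemma fps_split a : a = fpsC (a 0%N) + hbar * fps_shift 1 a.
Proof.
apply: fpsP => -[|n]; rewrite fps_coefD fps_coefXM /= ?addr0 ?add0r //.
by rewrite addn1.
Qed.

Lemma fcalc1 chi : fcalc chi 1 = 1.
Proof.
apply/esym/fcalc_unique => -[|N]; first exact: cord0.
rewrite /fcalc_part big_ord_recl fps_coef1 rmorph1 scale1r expr0 big1 ?addr0 ?subrr.
  by exists 0; rewrite scaler0.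
by move=> i _; rewrite fps_coef1 rmorph0 scale0r.
Qed.

Lemma fcalcC chi (u : k) : fcalc chi (fpsC u) = fpsC u *: 1.
Proof. by rewrite -[fpsC u]mulr1 fcalcCM fcalc1 mulr1. Qed.

(* With a = a_0 + X a', an error of order N for a' is one of order N + 1 for a. *)
Lemma fcalcM chi a b : fcalc chi (a * b) = fcalc chi a * fcalc chi b.
Proof.
apply: ca_separated => N; elim: N a => [|N IH] a; first exact: cord0.
rewrite {1 2}[a]fps_split mulrDl -mulrA !raddfD /= fcalcCM !fcalcXM fcalcC.
rewrite mulrDl -(scalerAl _ 1) mul1r opprD addrACA subrr add0r -mulrA -mulrBr.
have [r ->] := IH (fps_shift 1 a); exists (chi * r).
by rewrite -scalerAl -scalerAr scalerA -exprS.
Qed.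

HB.instance Definition _ chi :=
  GRing.isMonoidMorphism.Build (fps k) (conv_alg F) (fcalc chi)
    (fcalc1 chi, fcalcM chi).

(** On the left [hbar] is the formal variable of the series, on the right the deformation
    parameter. *)
Lemma fcalcX chi : fcalc chi hbar = hbar *: chi.
Proof. by rewrite -[hbar]mulr1 fcalcXM fcalc1 !mulr1. Qed.

Lemma fcalc_hord chi N a : hord N a -> cord N (fcalc chi a).
Proof.
move=> /hordP[b ->]; rewrite rmorphM rmorphXn /= fcalcX exprZn -scalerAl.
by exists (chi ^+ N * fcalc chi b).
Qed.

Lemma fcalc_flip chi a : ca_flip (fcalc chi a) = fcalc (ca_flip chi) a.
Proof.
apply: fcalc_unique => N.
have -> : fcalc_part (ca_flip chi) a N = ca_flip (fcalc_part chi a N).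
  rewrite raddf_sum; apply: eq_bigr => n _.
  by rewrite /= ca_flipZ rmorphXn /= ca_flipZ.
rewrite -raddfB /=; have [r ->] := fcalc_cord chi a N.
by exists (ca_flip r); rewrite ca_flipZ.
Qed.

Hypothesis char0 : [pchar k] =i pred0.

Definition ca_exp chi := fcalc chi (fps_exp k).

Lemma fcalc_expN chi : fcalc chi (fps_expN k) = ca_exp (- chi).
Proof.
apply: fcalc_unique => N.
rewrite (@fcalc_part_eq (- chi) chi _ (fps_expN k)); first exact: fcalc_cord.
move=> n _; rewrite scalerN exprNn -signr_odd.
rewrite -[fps_expN k n]/((-1) ^+ n * n`!%:R^-1) -[in RHS]signr_odd.
have [_|_] := boolP (odd n); rewrite ?expr1 ?expr0 ?mulN1r ?mul1r //.
by rewrite rmorphN scalerN scaleNr.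
Qed.

Lemma ca_expNK chi : ca_exp (- chi) * ca_exp chi = 1.
Proof. by rewrite -fcalc_expN -rmorphM fps_expN_exp // rmorph1. Qed.

Lemma ca_expKN chi : ca_exp chi * ca_exp (- chi) = 1.
Proof. by rewrite -{1}[chi]opprK ca_expNK. Qed.

(** Image of the formal identity log(exp(X)) = X under the ring morphism [fcalc chi], which keeps
    the order of the error. *)
Lemma ca_log_exp chi N : cord N (\sum_(1 <= n < N)
  fpsC ((-1) ^+ n.+1 / n%:R) *: (ca_exp chi - 1) ^+ n - hbar *: chi).
Proof.
have := fcalc_hord chi (fps_log_exp char0 (N := N)).
rewrite raddfB /= fcalcX /fps_log_trunc raddf_sum /=.
congr (cord N (_ - _)); apply: eq_bigr => n _.
by rewrite fcalcCM rmorphXn rmorphB rmorph1.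
Qed.

Lemma ca_exp_inj : injective ca_exp.
Proof.
move=> chi psi E; apply: ca_hbar_inj; apply: ca_separated => N.
apply: cord_sub_trans (ca_log_exp psi N); apply: cord_sub_sym.
by have := ca_log_exp chi N; rewrite E.
Qed.

Lemma ca_exp_orthogonal chi :
  ca_exp chi * ca_flip (ca_exp chi) = 1 <-> ca_flip chi = - chi.
Proof.
rewrite fcalc_flip -/(ca_exp _); split=> [E | ->]; last exact: ca_expKN.
(* A right inverse of exp(hbar chi) equals its left inverse exp(-hbar chi), and an exponential
   determines its exponent. *)
apply: ca_exp_inj; rewrite -[LHS]mul1r -(ca_expNK chi) -mulrA E.
by rewrite mulr1.
Qed.

End FunctionalCalculus.

(** * The quantised enveloping algebra and its Drinfeld dual *)

Section Enveloping.
Variables (k : fieldType) (g : vectType k) (br : g -> g -> g).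
Variables (A : algType k) (i : {linear g -> A}) (env : is_enveloping br i).
Variable P : {pred A}.
Hypotheses (P_alg : subalg_closed P) (P_i : forall x, i x \in P).

#[local] HB.instance Definition _ := GRing.isSubalgClosed.Build k A P P_alg.

Record gen_sub := GenSub { gen_val :> A; _ : gen_val \in P }.
#[local] HB.instance Definition _ := [isSub for gen_val].
#[local] HB.instance Definition _ := [Choice of gen_sub by <:].
#[local] HB.instance Definition _ := [SubChoice_isSubAlgebra of gen_sub by <:].

Definition gen_in (x : g) : gen_sub := GenSub (P_i x).

Fact gen_in_linear : linear gen_in.
Proof. by move=> c x y; apply: val_inj; rewrite /= linearP. Qed.
#[local] HB.instance Definition _ :=
  GRing.isLinear.Build k g gen_sub _ gen_in gen_in_linear.

Definition gen_incl (x : gen_sub) : A := val x.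

Fact gen_incl_linear : linear gen_incl.
Proof. by move=> c x y; rewrite /gen_incl linearP. Qed.
Fact gen_incl_monoid_morphism : monoid_morphism gen_incl.
Proof. by split=> [|x y]; rewrite /gen_incl ?rmorph1 ?rmorphM. Qed.
#[local] HB.instance Definition _ :=
  GRing.isLinear.Build k gen_sub A _ gen_incl gen_incl_linear.
#[local] HB.instance Definition _ :=
  GRing.isMonoidMorphism.Build gen_sub A gen_incl gen_incl_monoid_morphism.

(** The universal property maps A into the subalgebra P. Composed with the inclusion, this map fixes
    the image of g, so by uniqueness it is the identity of A. *)
Lemma enveloping_gen (a : A) : a \in P.
Proof.
have [i_hom univ] := env.
have gen_hom : lie_hom br (gen_in : {linear g -> gen_sub}).
  by move=> x y; apply: val_inj; rewrite /= i_hom.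
have [h [hi _]] := univ _ _ gen_hom.
have [e [_ e_uniq]] := univ _ i i_hom.
have vh x : (gen_incl \o h) (i x) = i x by rewrite /= hi.
have -> : a = gen_incl (h a).
  rewrite -[RHS]/((gen_incl \o h) a).
  rewrite (e_uniq (gen_incl \o h : {lrmorphism A -> A}) vh a).
  exact: (e_uniq (idfun : {lrmorphism A -> A}) (fun=> erefl) a).
exact: valP.
Qed.

End Enveloping.

Section QUEAForms.
Variables (k : fieldType) (g : vectType k) (br : g -> g -> g) (U : QUEA br).
Local Notation K := (fps k).
Local Notation O := (quea_ops U).
Implicit Types (f h : U -> U -> K) (a b x y : U).

Lemma mlin_form2P f : form2 (@mlin k U) f <-> bilin f.
Proof. exact: mlin2P. Qed.

Lemma mlin_form1P (l : U -> K) : form1 (@mlin k U) l <-> klinear l.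
Proof. exact: mlin1P. Qed.

Lemma bilin_lin_closed (M : lmodType K) : lin_closed (@bilin k M).
Proof. by split; [exact: bilin0 | move=> c *; exact: bilin_lin]. Qed.

Lemma quea_cop_lin a : lin_on (@bilin k U) (cop O a).
Proof. exact/ctens2_lin/(hopf_cop_tens (quea_hopf U)). Qed.

Lemma quea_cop_klinear f : bilin f -> klinear (fun a => cop O a f).
Proof.
by move=> /mlin_form2P hf; apply/mlin_form1P/(hopf_cop_cont (quea_hopf U)).
Qed.

Lemma quea_eps_klinear : klinear (eps O).
Proof. exact/mlin_form1P/(hopf_eps_cont (quea_hopf U)). Qed.

Lemma quea_cop_inner_bilin f h b : bilin f -> bilin h ->
  bilin (fun a1 a2 => cop O b (fun b1 b2 => f a1 b1 * h a2 b2)).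
Proof.
move=> hf hh.
have inner x y : bilin (fun b1 b2 => f x b1 * h y b2).
  exact: bilin_rank1 (hf.2 x) (hh.2 y).
split=> z c x y.
- rewrite -(quea_cop_lin b c (inner x z) (inner y z)); congr cop.
  by apply/funext => s; apply/funext => t; rewrite (hf.1 s); ring.
- rewrite -(quea_cop_lin b c (inner z x) (inner z y)); congr cop.
  by apply/funext => s; apply/funext => t; rewrite (hh.1 t); ring.
Qed.

Lemma quea_conv_bilin f h : bilin f -> bilin h -> bilin (conv O f h).
Proof.
move=> hf hh; split=> z c x y.
  exact: (quea_cop_klinear (quea_cop_inner_bilin z hf hh)).
rewrite /conv -(quea_cop_lin z); try exact: quea_cop_inner_bilin.
congr cop; apply/funext => s; apply/funext => t.
by apply: quea_cop_klinear; apply: bilin_rank1 (hf.2 s) (hh.2 t).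
Qed.

Lemma quea_conv1_bilin : bilin (conv1 O).
Proof. by apply: bilin_rank1; apply: quea_eps_klinear. Qed.

Lemma quea_conv_pow_bilin f n : bilin f -> bilin (conv_pow O f n).
Proof.
move=> hf; elim: n => [|n IH]; first exact: quea_conv1_bilin.
exact: quea_conv_bilin.
Qed.

Lemma polar_num_bilin f N : bilin f -> bilin (polar_num f N).
Proof.
move=> hf; apply: (lin_closed_sum (bilin_lin_closed U)) => n.
by apply: lin_closedZ; [apply: bilin_lin_closed | apply: quea_conv_pow_bilin].
Qed.

Lemma bilin_mull f x : bilin f -> bilin (fun a b => f (a * b) x).
Proof.
move=> hf; split=> z c a b; first by rewrite mulrDl -scalerAl hf.1.
by rewrite mulrDr -scalerAr hf.1.
Qed.

Lemma bilin_mulr f x : bilin f -> bilin (fun a b => f x (a * b)).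
Proof.
move=> hf; split=> z c a b; first by rewrite mulrDl -scalerAl hf.2.
by rewrite mulrDr -scalerAr hf.2.
Qed.

Lemma delta1 a (l : U -> K) : klinear l ->
  delta 1 a (fun s => l s`_0) = l (a - eps O a *: 1).
Proof.
move=> hl; pose l' x := l (x - eps O x *: 1).
have hl' : klinear l'.
  move=> c x y; rewrite /l' -hl quea_eps_klinear; congr l.
  by rewrite scalerDl scalerBr scalerA opprD addrACA.
rewrite -[RHS]/(l' a) -(hopf_counitr (quea_hopf U) a (l := l')); last exact/mlin_form1P.
rewrite /=; congr cop; apply/funext => x; apply/funext => y.
by rewrite mulrC.
Qed.

(* An element of U' is a scalar modulo hbar, and forms vanishing on 1 do not see
   the scalar. *)
Lemma drinfeld_form_hord f a b : bilin f -> (forall z, f z 1 = 0 /\ f 1 z = 0) ->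
  drinfeld a -> drinfeld b -> hord 2 (f a b).
Proof.
move=> hf f1 /(_ 1%N)[t [t_tens ta]] /(_ 1%N)[u [_ ub]].
have fb x : hord 1 (f x b).
  have := ub _ (proj2 (mlin1P (f x)) (hf.2 x)); rewrite delta1; last exact: hf.2.
  rewrite (klinearB _ _ (hf.2 x)) (klinearZ _ _ (hf.2 x)) (f1 x).1 mulr0 subr0 => ->.
  exact: hord_hbarX.
have -> : f a b = delta 1 a (fun s => f s`_0 b).
  apply/esym; apply: etrans (delta1 a (hf.1 b)) _.
  by rewrite (klinearB _ _ (hf.1 b)) (klinearZ _ _ (hf.1 b)) (f1 b).2 mulr0 subr0.
rewrite (ta _ (proj2 (mlin1P (f^~ b)) (hf.1 b))).
apply: (@hordM _ 1 1); first by rewrite -[X in hord 1 X]mulr1; apply: hord_hbarX.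
(* The second factor hbar: modulo hbar, [t] is a finite sum of values of f(-, b), all divisible by
   hbar. *)
have [L [_ tL]] := t_tens 1%N.
have := tL _ (proj2 (mlin1P (f^~ b)) (hf.1 b)).
move=> h; rewrite -(subrK (\sum_(p <- L) p.1 * f p.2`_0 b) (t _)).
by apply: hordD h _; apply: hord_sum => p _; apply: hordMl.
Qed.

End QUEAForms.

(** * Comparison of U with F along [dd_in], and density of the span of U' *)

Section Transfer.
Variables (k : fieldType) (g : vectType k) (br : g -> g -> g).
Variables (U : QUEA br) (F : QFSHA k) (D : drinfeld_dual U F).
Local Notation K := (fps k).
Local Notation OU := (quea_ops U).
Local Notation O := (qf_ops F).
Local Notation i := (dd_in D).
Local Notation cf2 := (cform2 (qf_coord (q := F))).
Implicit Types (f h : F -> F -> K) (fU hU : U -> U -> K) (a b x y : F).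

Lemma pull_cform2 fU : bilin fU -> cf2 (fun x y => fU (i x) (i y)).
Proof.
move=> hf; split.
  by split=> z c x y; rewrite linearP ?hf.1 ?hf.2.
move=> N; have [S [d iS]] := dd_cont D N; exists S, d => x y /iS [u ->].
rewrite (klinearZ _ _ (hf.1 _)) (klinearZ _ _ (hf.2 _)).
by split; apply: hord_hbarX.
Qed.

(** The coproducts of U and F are compared only on forms pulled back from U, so the powers of hbar
    are first moved back inside both Sweedler sums. *)
Lemma conv_transfer p q fU hU f h a b : bilin fU -> bilin hU -> cf2 f -> cf2 h ->
  (forall x y, fU (i x) (i y) = hbar ^+ p * f x y) ->
  (forall x y, hU (i x) (i y) = hbar ^+ q * h x y) ->
  conv OU fU hU (i a) (i b) = hbar ^+ (p + q) * conv O f h a b.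
Proof.
move=> hfU hhU hf hh fE hE; rewrite /conv.
have inU := quea_cop_inner_bilin (i b) hfU hhU.
have inF x y : cf2 (fun b1 b2 => f x b1 * h y b2).
  by apply: cform2_rank1; apply: cform2_partial_r.
have PL := cform2_lin_closed (qf_coord (q := F)).
rewrite -(lin_onZ PL (@qf_cop_lin _ _ a)); last exact: cop_inner_cform2.
rewrite -(dd_cop D); last exact/mlin_form2P.
congr cop; apply/funext => x; apply/funext => y.
rewrite -(lin_onZ PL (@qf_cop_lin _ _ b)) // -(dd_cop D); last first.
  exact/mlin_form2P/(bilin_rank1 (hfU.2 _) (hhU.2 _)).
congr cop; apply/funext => s; apply/funext => t.
by rewrite fE hE exprD; ring.
Qed.

Lemma conv_pow_transfer d fU (f : conv_alg F) n a b : bilin fU ->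
  (forall x y, fU (i x) (i y) = hbar ^+ d * f x y) ->
  conv_pow OU fU n (i a) (i b) = hbar ^+ (d * n) * (f ^+ n : conv_alg F) a b.
Proof.
move=> hfU fE; elim: n a b => [|n IH] a b.
  by rewrite muln0 mul1r /= /conv1 !dd_eps.
rewrite exprS mulnS; apply: conv_transfer => //; try exact: conv_funP.
exact: quea_conv_pow_bilin.
Qed.

Lemma dd_drinfeld a : drinfeld (i a).
Proof. by apply/(dd_image D); exists a. Qed.

Lemma dd_polar_dom a : polar_dom (i a).
Proof. by exists 0%N; rewrite expr0 scale1r; apply: dd_drinfeld. Qed.

(** U' is the image of an algebra morphism, so the powers of its augmentation ideal stay inside
    it. *)
Lemma aug_pow_drinfeld n (u : U) : aug_pow OU (@drinfeld _ _ _ U) n u ->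
  exists a, i a = u.
Proof.
elim: n u => [|n IH] u; first by move/(dd_image D).
case=> L [hL ->]; elim: L hL => [|p L IHL] hL.
  by exists 0; rewrite big_nil linear0.
have [[b [c [/(dd_image D)[b' <-] /(dd_image D)[c' <-] _ pE]]] /IH[d dE]] :=
  hL p (mem_head _ _).
have [e eE] := IHL (fun q qL => hL q (mem_behead (s := p :: L) qL)).
exists ((hbar *: b' + c') * d + e).
by rewrite big_cons linearD /= rmorphM /= linearP pE dE eE.
Qed.

Lemma polar_dom_scaled (u : U) : polar_dom u -> exists n a, i a = hbar ^+ n *: u.
Proof. by move=> [n /aug_pow_drinfeld[a]]; exists n, a. Qed.

(** The union of the hbar^(-n) U'. Powers of the ideal are not tracked, since rescaling and density
    only require some hbar-power multiple in U'. *)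
Definition dd_span (u : U) : Prop := exists n a, i a = hbar ^+ n *: u.

Lemma dd_span_lin c u v : dd_span u -> dd_span v -> dd_span (c *: u + v).
Proof.
move=> [n [a aE]] [m [b bE]]; exists (n + m)%N, ((hbar ^+ m * c) *: a + hbar ^+ n *: b).
rewrite linearP linearZ /= aE bE !scalerA scalerDr scalerA exprD.
by congr (_ *: _ + _); ring.
Qed.

Lemma dd_span1 : dd_span 1.
Proof. by exists 0%N, 1; rewrite rmorph1 scale1r. Qed.

Lemma dd_spanM u v : dd_span u -> dd_span v -> dd_span (u * v).
Proof.
move=> [n [a aE]] [m [b bE]]; exists (n + m)%N, (a * b).
by rewrite rmorphM /= aE bE -scalerAl -scalerAr scalerA exprD.
Qed.

Lemma dd_span_lift (x : g) : exists2 y, dd_span y & red U y = env_in U x.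
Proof.
have [a am ax] := dd_cot_surj D x.
have /(dd_cotP D _ am)[y [b [yx _ bE _]]] := ax.
by exists y => //; exists 1%N, b; rewrite expr1.
Qed.

(* The lifts of elements of g generate U modulo hbar. *)
Lemma dd_span_red (e : env U) : exists2 u, dd_span u & red U u = e.
Proof.
pose P : {pred env U} := [pred e : env U | `[< exists2 u, dd_span u & red U u = e >]].
have PE e' : reflect (exists2 u, dd_span u & red U u = e') (e' \in P) by apply: asboolP.
apply/PE; apply: (enveloping_gen (env_univ U)) => [|x]; last first.
  exact/PE/dd_span_lift.
split.
- by apply/PE; exists 1; [exact: dd_span1 | rewrite rmorph1].
- move=> c _ _ /PE[u hu <-] /PE[v hv <-]; apply/PE; exists (fpsC c *: u + v).
    exact: dd_span_lin.
  by rewrite rmorphD /= redZ.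
- move=> _ _ /PE[u hu <-] /PE[v hv <-]; apply/PE; exists (u * v).
    exact: dd_spanM.
  by rewrite rmorphM.
Qed.

(** Successive approximation: the remainder w is itself matched modulo hbar by an element of the
    span. *)
Lemma dd_span_dense N (u : U) : exists v w, dd_span v /\ u = v + hbar ^+ N *: w.
Proof.
elim: N u => [|N IH] u.
  exists 0, u; rewrite scale1r add0r; split=> //.
  by exists 0%N, 0; rewrite linear0 scaler0.
have [v [w [hv ->]]] := IH u.
have [w0 hw0 w0E] := dd_span_red (red U w).
have [w1 w1E] : in_hpow 1 (w - w0) by apply/red_ker; rewrite rmorphB /= w0E subrr.
exists (hbar ^+ N *: w0 + v), w1; split; first exact: dd_span_lin.
have -> : w = w0 + hbar ^+ 1 *: w1 by rewrite -w1E addrC subrK.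
by rewrite scalerDr scalerA -exprD addn1 addrA [v + _]addrC.
Qed.

(** Vanishing extends from U' to the span because k[[hbar]] has no hbar-torsion, then to U because a
    bilinear form is automatically hbar-adically continuous. *)
Lemma dd_span_bilin_eq0 fU : bilin fU -> (forall a b, fU (i a) (i b) = 0) ->
  forall u v, fU u v = 0.
Proof.
move=> hf f0.
have f0s u v : dd_span u -> dd_span v -> fU u v = 0.
  move=> [n [a aE]] [m [b bE]]; apply: (@hbarX_inj _ (n + m)) => /=.
  have := f0 a b; rewrite aE bE (klinearZ _ _ (hf.1 _)) (klinearZ _ _ (hf.2 _)).
  by rewrite mulrA -exprD mulr0.
move=> u v; apply: fps_separated => N; rewrite subr0.
have [u' [u'' [hu ->]]] := dd_span_dense N u.
have [v' [v'' [hv ->]]] := dd_span_dense N v.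
rewrite (klinearD _ _ (hf.1 _)) (klinearZ _ _ (hf.1 _)).
apply: hordD; last exact: hord_hbarX.
rewrite (klinearD _ _ (hf.2 _)) (klinearZ _ _ (hf.2 _)) f0s // add0r.
exact: hord_hbarX.
Qed.

End Transfer.

(** * The 2-cocycles chi and sigma *)

Section Pullback.
Variables (k : fieldType) (F : QFSHA k).
Implicit Types (f g : conv_alg F) (a b c : F).

Lemma qf_mul_cform2 (l : F -> fps k) : cform1 (qf_coord (q := F)) l ->
  cform2 (qf_coord (q := F)) (fun x y => l (x * y)).
Proof. by move=> /form1P hl; apply/form2P/(hopf_mul_cont (qf_hopf F)). Qed.

Definition ca_mull f c : conv_alg F :=
  ConvAlg (qf_mul_cform2 (cform2_partial_l c (conv_funP f))).
Definition ca_mulr a f : conv_alg F :=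
  ConvAlg (qf_mul_cform2 (cform2_partial_r a (conv_funP f))).

(** Both sides of the cocycle identity are written as convolution products, so that limits and
    expansions modulo hbar^2 take place in the algebra [conv_alg F]. *)
Definition hopf_2cocycle f := forall a b c,
  (f * ca_mull f c) a b = (f * ca_mulr a f) b c.

Lemma ca_mull_cord N f g c : cord N (f - g) -> cord N (ca_mull f c - ca_mull g c).
Proof. by move=> /cordP fg; apply/cordP => x y; apply: fg. Qed.

Lemma ca_mulr_cord N f g a : cord N (f - g) -> cord N (ca_mulr a f - ca_mulr a g).
Proof. by move=> /cordP fg; apply/cordP => x y; apply: fg. Qed.

Lemma cordM_sub N f f' g g' : cord N (f - f') -> cord N (g - g') ->
  cord N (f * g - f' * g').
Proof.
move=> hf hg; apply: cord_sub_trans (_ : cord N (f' * g - _)).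
  by rewrite -mulrBl; apply: cordMr.
by rewrite -mulrBr; apply: cordMl.
Qed.

Local Notation e a := (eps (qf_ops F) a 0%N).

(** * The infinitesimal cocycle identity and the vanishing on m^2 *)

Section Hochschild.
Variables (X : conv_alg F) (cocycle : hopf_2cocycle (ca_exp X)).

(* The coefficient of hbar in the cocycle identity for [1 + hbar X + ...]. *)
Lemma hochschild_mod a b c :
  e c * X a b 0%N + X (a * b) c 0%N = e a * X b c 0%N + X a (b * c) 0%N.
Proof.
set s := ca_exp X; pose s1 := 1 + hbar *: X.
have s_s1 : cord 2 (s - s1).
  have := fcalc_cord X (fps_exp k) 2.
  rewrite /fcalc_part big_ord_recl big_ord1 expr0 expr1 /=.
  by rewrite fact0 invr1 rmorph1 !scale1r.
have eps_mull (t : F) : ca_mull 1 t = eps (qf_ops F) t *: 1.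
  apply: conv_algP => x y /=; rewrite /conv1 (hopf_epsM (qf_hopf F)).
  by rewrite mulrC.
have eps_mulr (t : F) : ca_mulr t 1 = eps (qf_ops F) t *: 1.
  by apply: conv_algP => x y /=; rewrite /conv1 (hopf_epsM (qf_hopf F)).
have hl := cordM_sub s_s1 (ca_mull_cord c s_s1).
have hr := cordM_sub s_s1 (ca_mulr_cord a s_s1).
have mullE : ca_mull s1 c = eps (qf_ops F) c *: 1 + hbar *: ca_mull X c.
  by rewrite -eps_mull; apply: conv_algP.
have mulrE : ca_mulr a s1 = eps (qf_ops F) a *: 1 + hbar *: ca_mulr a X.
  by rewrite -eps_mulr; apply: conv_algP.
have addends (A B C E : conv_alg F) : A + C + (B + E) - (A + (B + C)) = E.
  by rewrite [B + C]addrC !addrA [LHS]addrAC subrr add0r.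
have expand t Y : s1 * (t *: 1 + hbar *: Y) - (t *: 1 + hbar *: (t *: X + Y)) =
    hbar ^+ 2 *: (X * Y).
  rewrite mulrDl mul1r mulrDr -[_ * (t *: 1)]scalerAr mulr1.
  rewrite -[_ * (hbar *: Y)]scalerAl -scalerAr !scalerA -expr2.
  rewrite scalerDr scalerA [hbar * t]mulrC.
  exact: addends.
have hl0 : hord 2 ((s * ca_mull s c) a b -
    (eps (qf_ops F) c *: 1 + hbar *: (eps (qf_ops F) c *: X + ca_mull X c) :
      conv_alg F) a b).
  rewrite -caB; apply: (proj1 (cordP _ _)); apply: cord_sub_trans hl _.
  by rewrite mullE expand; eexists.
have hr0 : hord 2 ((s * ca_mulr a s) b c -
    (eps (qf_ops F) a *: 1 + hbar *: (eps (qf_ops F) a *: X + ca_mulr a X) :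
      conv_alg F) b c).
  rewrite -caB; apply: (proj1 (cordP _ _)); apply: cord_sub_trans hr _.
  by rewrite mulrE expand; eexists.
have := hord_sub_trans (hord_sub_sym hl0); rewrite cocycle => /(_ _ hr0).
rewrite !caD !caZ /= /conv1.
(* The terms of order 0 on both sides are the same product of three counits; they cancel, and one
   hbar can be divided out. *)
have -> : forall u v w y z : fps k, z * (u * v) + hbar * w - (u * (v * z) + hbar * y) =
  hbar ^+ 1 * (w - y) by move=> u v w y z; ring.
move=> /(@hord_cancel _ 1 1) /hord_coef0.
by rewrite !fps_coefD !fps_coefM !big_ord1.
Qed.

Lemma eps0M a b : e (a * b) = e a * e b.
Proof. by rewrite (hopf_epsM (qf_hopf F)) fps_coefM big_ord1. Qed.

Lemma red0_mulC a b c : X (a * b) c 0%N = X (b * a) c 0%N /\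
  X c (a * b) 0%N = X c (b * a) 0%N.
Proof.
have [z zE] := qf_comm a b; have [[Xl Xr] _] := conv_funP X.
split; apply: hord_coef0.
  by rewrite -(klinearB _ _ (Xl c)) zE (klinearZ _ _ (Xl c)); apply: hord_hbarX.
by rewrite -(klinearB _ _ (Xr c)) zE (klinearZ _ _ (Xr c)); apply: hord_hbarX.
Qed.

(** The identity is used at (a, b, c), (c, a, b) and (a, c, b). By commutativity modulo hbar, X(a,
    bc) matches X(a, cb) and X(ca, b) matches X(ac, b), while the terms in X(a, b) cancel. *)
Lemma antisym_derivation a b c :
  (X (a * b) c - X c (a * b)) 0%N =
  e a * (X b c - X c b) 0%N + e b * (X a c - X c a) 0%N.
Proof.
rewrite !fps_coefD !fps_coefN.
have E1 := hochschild_mod a b c; have E2 := hochschild_mod c a b.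
have E3 := hochschild_mod a c b.
have C1 := (red0_mulC c a b).1; have C2 := (red0_mulC b c a).2.
have -> : X (a * b) c 0%N = e a * X b c 0%N + X a (b * c) 0%N - e c * X a b 0%N.
  by rewrite -E1 addrC addKr.
have -> : X c (a * b) 0%N = e b * X c a 0%N + X (c * a) b 0%N - e c * X a b 0%N.
  by rewrite E2 addrC addKr.
have -> : X a (b * c) 0%N = e b * X a c 0%N + X (a * c) b 0%N - e a * X c b 0%N.
  by rewrite C2 E3 addrC addKr.
rewrite C1; ring.
Qed.

Lemma aug_ideal_eps0 (W : F -> Prop) a : aug_ideal (qf_ops F) W a -> e a = 0.
Proof.
move=> [b [c [_ _ c0 ->]]].
have [he _] := eps_cform1 F.
by rewrite he c0 addr0 fps_coefXM.
Qed.

Lemma aug_pow1_eps0 (W : F -> Prop) a : aug_pow (qf_ops F) W 1 a -> e a = 0.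
Proof.
move=> [L [hL ->]]; have [he _] := eps_cform1 F.
rewrite (klinear_sum _ _ _ he) fps_coef_sum big_seq big1 // => p /hL[p1 _].
by rewrite eps0M (aug_ideal_eps0 p1) mul0r.
Qed.

Lemma antisym_mpow2 a c : mpow (qf_ops F) 2 a -> (X a c - X c a) 0%N = 0.
Proof.
move=> [b [d [[L [hL ->]] ->]]].
pose w x := X x c - X c x.
have hw : klinear w.
  have [[Xl Xr] _] := conv_funP X.
  by move=> t x y; rewrite /w (Xl c) (Xr c); ring.
rewrite -[X _ _ - _]/(w _) (klinearD _ _ hw) (klinearZ _ _ hw) (klinear_sum _ _ _ hw).
rewrite fps_coefD fps_coefXM addr0 fps_coef_sum big_seq big1 // => p /hL[p1 p2].
by rewrite antisym_derivation (aug_ideal_eps0 p1) (aug_pow1_eps0 p2) !mul0r addr0.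
Qed.

Lemma antisym_mpow2_sub a a' b b' :
  mpow (qf_ops F) 2 (a - a') -> mpow (qf_ops F) 2 (b - b') ->
  (X a b - X b a) 0%N = (X a' b' - X b' a') 0%N.
Proof.
have [[Xl Xr] _] := conv_funP X.
move=> /antisym_mpow2 ha /antisym_mpow2 hb.
transitivity ((X a' b - X b a') 0%N).
  apply/eqP; rewrite -subr_eq0 -fps_coefN -fps_coefD -(ha b); apply/eqP.
  by rewrite (klinearB _ _ (Xl b)) (klinearB _ _ (Xr b)); congr (coefs _ _); ring.
apply/eqP; rewrite -subr_eq0 -fps_coefN -fps_coefD -oppr0 -(hb a') -fps_coefN.
apply/eqP.
by rewrite (klinearB _ _ (Xl a')) (klinearB _ _ (Xr a')); congr (coefs _ _); ring.
Qed.

End Hochschild.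
End Pullback.

(** * From the polar cocycle on U to sigma on F *)

Section Polar.
Variables (k : fieldType) (char0 : [pchar k] =i pred0).
Variables (g : vectType k) (br : g -> g -> g) (U : QUEA br) (F : QFSHA k).
Variables (D : drinfeld_dual U F) (chi : U -> U -> fps k).
Hypothesis polar_chi : polar_2cocycle chi.
Local Notation K := (fps k).
Local Notation OU := (quea_ops U).
Local Notation O := (qf_ops F).
Local Notation i := (dd_in D).
Implicit Types (a b c : F) (u v : U) (N : nat).

Fact chi_bilin : bilin chi.
Proof. by case: polar_chi => /mlin_form2P. Qed.

(** Dropping two coefficients is a genuine division by hbar^2 here, because of
    [drinfeld_form_hord]. *)
Definition dd_chi_fun a b : K := fps_shift 2 (chi (i a) (i b)).

Lemma dd_chi_funE a b : chi (i a) (i b) = hbar ^+ 2 * dd_chi_fun a b.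
Proof.
have [_ chi1 _] := polar_chi.
exact/hord_shift/(drinfeld_form_hord chi_bilin chi1)/dd_drinfeld/dd_drinfeld.
Qed.

Fact dd_chi_cform2 : cform2 (qf_coord (q := F)) dd_chi_fun.
Proof. exact: cform2_div (pull_cform2 D chi_bilin) dd_chi_funE. Qed.

Definition dd_chi : conv_alg F := ConvAlg dd_chi_cform2.
Local Notation X := dd_chi.

Lemma dd_chiE a b : chi (i a) (i b) = hbar ^+ 2 * X a b.
Proof. exact: dd_chi_funE. Qed.

Definition dd_sigma_part N : conv_alg F := fcalc_part X (fps_exp k) N.+1.
Local Notation s := (ca_exp X).

Lemma dd_sigma_part_cord N : cord N (dd_sigma_part N - s).
Proof.
apply/cord_sub_sym; have [r Er] := fcalc_cord X (fps_exp k) N.+1.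
by exists (hbar *: r); rewrite scalerA -exprSr.
Qed.

(** Term by term: hbar^(N-n) chi^n = hbar^(N-n) hbar^(2n) chi'^n = hbar^N (hbar chi')^n. Both sums
    have N+1 terms. *)
Lemma polar_num_dd N a b :
  polar_num chi N (i a) (i b) = hbar ^+ N * dd_sigma_part N a b.
Proof.
rewrite /polar_num /dd_sigma_part /fcalc_part ca_sum mulr_sumr.
apply: eq_bigr => n _.
rewrite (conv_pow_transfer n a b chi_bilin dd_chiE) exprZn !caZ.
have nN : (n <= N)%N by rewrite -ltnS.
rewrite -[fpsC (fps_exp k n)]/(fpsC n`!%:R^-1) mul2n -addnn exprD.
have -> : hbar ^+ N = hbar ^+ (N - n) * hbar ^+ n :> K by rewrite -exprD subnK.
ring.
Qed.

Lemma hcvg_cord (S : nat -> conv_alg F) (f : conv_alg F) a b :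
  (forall N, cord N (S N - f)) -> hcvg (fun N => S N a b) (f a b).
Proof.
move=> Sf; apply: hcvg_rate => N; rewrite -caB.
exact: (proj1 (cordP _ _)).
Qed.

Lemma polar_exp_dd a b : polar_exp chi (i a) (i b) (fps_laurent (s a b)).
Proof.
apply/(laurent_cvg_fps _ (v := fun N => dd_sigma_part N a b)).
  by move=> N; apply: polar_num_dd.
exact/hcvg_cord/dd_sigma_part_cord.
Qed.

Lemma dd_sigma_cocycle : hopf_2cocycle s.
Proof.
have [_ _ cocycle] := polar_chi; move=> a b c.
have [l [cvl cvr]] := cocycle _ _ _
  (dd_polar_dom D a) (dd_polar_dom D b) (dd_polar_dom D c).
have numB N := polar_num_bilin N chi_bilin.
have P_s := dd_sigma_part_cord.
apply: fps_laurent_inj => j.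
transitivity (lcoef l j).
  apply: (laurent_cvg_unique _ cvl).
  apply/(laurent_cvg_fps _
    (v := fun N => (dd_sigma_part N * ca_mull (dd_sigma_part N) c) a b)).
    (* Each of the two partial sums contributes hbar^N, which together match the denominator hbar^(N
       + N) of the polar identity. *)
    move=> N; apply: (conv_transfer (p := N) (q := N) a b (numB N)
      (bilin_mull (i c) (numB N)) (conv_funP _) (conv_funP (ca_mull _ c))).
      by move=> x y; apply: polar_num_dd.
    by move=> x y /=; rewrite -rmorphM; apply: polar_num_dd.
  apply: (hcvg_cord (S := fun N => _ * _)) => N.
  exact/cordM_sub/ca_mull_cord.
apply: (laurent_cvg_unique cvr).
apply/(laurent_cvg_fps _
  (v := fun N => (dd_sigma_part N * ca_mulr a (dd_sigma_part N)) b c)).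
  move=> N; apply: (conv_transfer (p := N) (q := N) b c (numB N)
    (bilin_mulr (i a) (numB N)) (conv_funP _) (conv_funP (ca_mulr a _))).
    by move=> x y; apply: polar_num_dd.
  by move=> x y /=; rewrite -rmorphM; apply: polar_num_dd.
apply: (hcvg_cord (S := fun N => _ * _)) => N.
exact/cordM_sub/ca_mulr_cord.
Qed.

(** With one factor X on the left, the normalisation of sigma at the unit follows from that of X. *)
Lemma ca_exp_split : exists h : conv_alg F, s = 1 + hbar *: (X * h).
Proof.
exists (fcalc X (fps_shift 1 (fps_exp k))).
rewrite /ca_exp {1}[fps_exp k]fps_split raddfD /= fcalcC fcalcXM scalerAl.
by rewrite fact0 invr1 rmorph1 scale1r.
Qed.

Lemma dd_chi1 a : X a 1 = 0 /\ X 1 a = 0.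
Proof.
have [_ chi1 _] := polar_chi; split; apply: (@hbarX_inj _ 2) => /=.
  by rewrite -dd_chi_funE rmorph1 (chi1 _).1 mulr0.
by rewrite -dd_chi_funE rmorph1 (chi1 _).2 mulr0.
Qed.

Lemma dd_sigma1 a : s a 1 = eps O a /\ s 1 a = eps O a.
Proof.
have [h ->] := ca_exp_split.
have PL := cform2_lin_closed (qf_coord (q := F)).
have [e1 [F0 _]] := (hopf_eps1 (qf_hopf F), PL).
have hX x y : form2 (cmlin (qf_coord (q := F))) (fun b1 b2 => X x b1 * h y b2).
  by apply/form2P/cform2_rank1; apply: cform2_partial_r; apply: conv_funP.
have cop0 x : cop O x (fun _ _ => 0) = 0 by apply: (lin_on0 PL (@qf_cop_lin _ _ x)).
have Xh1 : (X * h) a 1 = 0.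
  rewrite -[LHS]/(conv O X h a 1) /conv -[RHS](cop0 a); congr cop.
  apply/funext => x; apply/funext => y.
  by rewrite (hopf_cop1 (qf_hopf F) (hX x y)) (dd_chi1 x).1 mul0r.
have X1h : (X * h) 1 a = 0.
  rewrite -[LHS]/(conv O X h 1 a) /conv (hopf_cop1 (qf_hopf F)); last first.
    by apply/form2P/cop_inner_cform2; apply: conv_funP.
  rewrite -[RHS](cop0 a); congr cop; apply/funext => x; apply/funext => y.
  by rewrite (dd_chi1 x).2 mul0r.
by rewrite !caD !caZ Xh1 X1h mulr0 !addr0 /= /conv1 e1 mulr1 mul1r.
Qed.

Lemma dd_sigma_2cocycle : is_2cocycle (cmlin (qf_coord (q := F))) O s.
Proof.
split; first exact/form2P/conv_funP.
- exists (ca_exp (- X)); split; first exact/form2P/conv_funP.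
    by move=> a b; have := congr1 (fun f : conv_alg F => f a b) (ca_expKN char0 X).
  by move=> a b; have := congr1 (fun f : conv_alg F => f a b) (ca_expNK char0 X).
- exact: dd_sigma1.
exact: dd_sigma_cocycle.
Qed.

Lemma dd_sigma_exp : is_exp_conv O (fun a b => hbar * X a b) s.
Proof.
move=> a b; have -> : (fun N => \sum_(n < N) fpsC n`!%:R^-1 *
    conv_pow O (fun a b => hbar * X a b) n a b) =
    fun N => fcalc_part X (fps_exp k) N a b.
  apply/funext => N; rewrite /fcalc_part ca_sum; apply: eq_bigr => n _.
  by rewrite caZ -conv_powE.
by apply: hcvg_cord => N; apply/cord_sub_sym/fcalc_cord.
Qed.

Lemma dd_sigma_log : is_log_conv O s (fun a b => hbar * X a b).
Proof.
move=> a b; have s1 : (fun x y => s x y - conv1 O x y) = (s - 1 : conv_alg F).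
  by apply/funext => x; apply/funext => y; rewrite caB.
rewrite s1; have -> : (fun N => \sum_(1 <= n < N) fpsC ((-1) ^+ n.+1 / n%:R) *
    conv_pow O (s - 1 : conv_alg F) n a b) = fun N => (\sum_(1 <= n < N)
      fpsC ((-1) ^+ n.+1 / n%:R) *: (s - 1) ^+ n : conv_alg F) a b.
  apply/funext => N; rewrite ca_sum; apply: eq_bigr => n _.
  by rewrite caZ -conv_powE.
exact: (hcvg_cord _ _ (ca_log_exp char0 X)).
Qed.

Lemma antisym_dd_chiP : antisym X <-> ca_flip X = - X.
Proof.
split=> [XN | XN a b].
  by apply: conv_algP => a b; rewrite caN -XN.
by rewrite -caN -XN.
Qed.

Lemma antisym_chiP : antisym chi <-> antisym X.
Proof.
split=> [chiN a b | XN].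
  apply: (@hbarX_inj _ 2) => /=.
  by rewrite mulrN -!dd_chi_funE -chiN.
have PB := bilin_lin_closed U.
have chiF : bilin (flip chi) by split; apply chi_bilin.
move=> u v; apply/eqP; rewrite -subr_eq0 opprK; apply/eqP.
apply: (dd_span_bilin_eq0 (D := D) (lin_closedD PB chiF chi_bilin)) => a b.
by rewrite /flip !dd_chiE -mulrDr -[X b a]/(flip X a b) XN addNr mulr0.
Qed.

(** In one direction testing on U' suffices. The converse must reach all of [polar_dom], whose
    elements are first rescaled into U'. *)
Lemma polar_orthogonalP : polar_orthogonal chi <-> ca_flip X = - X.
Proof.
have numB N := polar_num_bilin N chi_bilin.
have numF N : bilin (flip (polar_num chi N)) by split; apply (numB N).
have P_s := dd_sigma_part_cord.
have P_sF N : cord N (ca_flip (dd_sigma_part N) - ca_flip s).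
  by have [r Er] := P_s N; exists (ca_flip r); rewrite -raddfB /= Er ca_flipZ.
have num_dd N a b := polar_num_dd N a b.
have numF_dd N a b : flip (polar_num chi N) (i a) (i b) =
    hbar ^+ N * ca_flip (dd_sigma_part N) a b by apply: polar_num_dd.
split=> [orth | XN].
  apply/(ca_exp_orthogonal char0)/conv_algP => a b.
  have [cv _] := orth _ _ (dd_polar_dom D a) (dd_polar_dom D b).
  apply: fps_laurent_inj.
  have -> : (1 : conv_alg F) a b = conv1 OU (i a) (i b) by rewrite /conv1 !dd_eps.
  apply: (laurent_cvg_unique _ cv).
  apply/(laurent_cvg_fps _
    (v := fun N => (dd_sigma_part N * ca_flip (dd_sigma_part N)) a b)).
    by move=> N; apply: conv_transfer => //; apply: conv_funP.
  by apply: (hcvg_cord (S := fun N => _ * _)) => N; apply: cordM_sub.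
have sF : ca_flip s = ca_exp (- X) by rewrite fcalc_flip XN.
move=> u v /(polar_dom_scaled D)[n [a aE]] /(polar_dom_scaled D)[m [b bE]] /=.
have scaled f : bilin f -> hbar ^+ (n + m) * f u v = f (i a) (i b).
  move=> hf; rewrite aE bE (klinearZ _ _ (hf.1 _)) (klinearZ _ _ (hf.2 _)).
  by rewrite exprD; ring.
have one : fps_laurent (hbar ^+ (n + m) * conv1 OU u v) =
    fps_laurent ((1 : conv_alg F) a b).
  by rewrite scaled; [rewrite /= /conv1 !dd_eps | exact: quea_conv1_bilin].
split; apply: (laurent_cvgXM (n := n + m)); rewrite one.
  apply/(laurent_cvg_fps _
    (v := fun N => (dd_sigma_part N * ca_flip (dd_sigma_part N)) a b)).
    move=> N; rewrite scaled; last exact: quea_conv_bilin.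
    by apply: conv_transfer => //; apply: conv_funP.
  apply: (hcvg_cord (S := fun N => _ * _)) => N.
  by rewrite -(ca_expKN char0 X) -sF; apply: cordM_sub.
apply/(laurent_cvg_fps _
  (v := fun N => (ca_flip (dd_sigma_part N) * dd_sigma_part N) a b)).
  move=> N; rewrite scaled; last exact: quea_conv_bilin.
  by apply: conv_transfer => //; apply: conv_funP.
apply: (hcvg_cord (S := fun N => _ * _)) => N.
by rewrite -(ca_expNK char0 X) -sF; apply: cordM_sub.
Qed.

Definition cot_lift (x : g) : U := sval (cid (red_surj (q := U) (env_in U x))).

Definition chi_gamma (x y : g) : k :=
  (chi (cot_lift x) (cot_lift y) - chi (cot_lift y) (cot_lift x)) 0%N.

(** The kernel of [red] is hbar U, so chi modulo hbar does not depend on the lifts chosen in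
    [cot_lift]. *)
Lemma chi_gammaP : quea_gamma chi chi_gamma.
Proof.
have [chil chir] := chi_bilin.
have chi_mod u u' v v' : red U u = red U u' -> red U v = red U v' ->
    chi u v 0%N = chi u' v' 0%N.
  move=> uu vv; apply: hord_coef0; rewrite (bilinDB _ _ _ _ chi_bilin).
  have [w ->] : in_hpow 1 (u - u') by apply/red_ker; rewrite rmorphB /= uu subrr.
  have [z ->] : in_hpow 1 (v - v') by apply/red_ker; rewrite rmorphB /= vv subrr.
  rewrite (klinearZ _ _ (chil _)) (klinearZ _ _ (chir _)).
  by apply: hordD; apply: hord_hbarX.
have liftE x u : red U u = env_in U x -> red U (cot_lift x) = red U u.
  by rewrite /cot_lift; case: cid => /= w -> ->.
move=> x y u v ux vy; rewrite /chi_gamma !fps_coefD !fps_coefN.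
by congr (_ - _); apply: chi_mod; apply: liftE.
Qed.

Lemma qfsha_chi_gamma : qfsha_gamma D X chi_gamma.
Proof.
move=> a b am bm.
have [u [a' [ux _ a'E aa]]] := proj1 (dd_cotP D _ am) erefl.
have [v [b' [vy _ b'E bb]]] := proj1 (dd_cotP D _ bm) erefl.
rewrite /flip (antisym_mpow2_sub dd_sigma_cocycle aa bb) (chi_gammaP ux vy) /flip.
have [chil chir] := chi_bilin.
(* The factors hbar of the two representatives cancel exactly the hbar^(-2) in chi'. *)
have chiE w z c d : i c = hbar *: w -> i d = hbar *: z -> X c d = chi w z.
  move=> cE dE; apply: (@hbarX_inj _ 2) => /=; rewrite -dd_chi_funE cE dE.
  by rewrite (klinearZ _ _ (chil _)) (klinearZ _ _ (chir _)) mulrA.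
by rewrite (chiE u v) ?(chiE v u).
Qed.

End Polar.

Theorem theorem4p2p4
  (k : fieldType) (char0 : [pchar k] =i pred0)
  (g : vectType k) (br : g -> g -> g) (lie_br : is_lie br)
  (U : QUEA br) (F : QFSHA k) (D : drinfeld_dual U F)
  (chi : U -> U -> fps k) (polar_chi : polar_2cocycle chi) :
  exists chi' sigma : F -> F -> fps k,
    (* chi' = hbar^(-2) chi and sigma = exp_*(hbar^(-1) chi) on U', and
       chi' = hbar^(-1) log_*(sigma) *)
    [/\ form2 (cmlin (qf_coord (q := F))) chi',
        forall a b, hbar ^+ 2 * chi' a b = chi (dd_in D a) (dd_in D b),
        forall a b,
          polar_exp chi (dd_in D a) (dd_in D b) (fps_laurent (sigma a b))
      & is_log_conv (qf_ops F) sigma (fun a b => hbar * chi' a b)] /\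
    [/\ (* (a) *)
        (antisym chi <-> polar_orthogonal chi) /\
        (polar_orthogonal chi <-> antisym chi'),
        (* (b) *)
        is_exp_conv (qf_ops F) (fun a b => hbar * chi' a b) sigma /\
        is_2cocycle (cmlin (qf_coord (q := F))) (qf_ops F) sigma
      & (* (c) *)
        exists gamma gamma' : g -> g -> k,
          [/\ quea_gamma chi gamma, qfsha_gamma D chi' gamma'
            & gamma = gamma']].
Proof.
exists (dd_chi D polar_chi), (ca_exp (dd_chi D polar_chi)).
have orthP := polar_orthogonalP char0 D polar_chi.
have antiP := antisym_dd_chiP D polar_chi.
have chiP := antisym_chiP D polar_chi.
split; split.
- exact/form2P/conv_funP.
- by move=> a b; rewrite -dd_chi_funE.
- exact: polar_exp_dd.
- exact: dd_sigma_log.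
- by rewrite orthP chiP antiP.
- by split; [apply: dd_sigma_exp | apply: dd_sigma_2cocycle].
(* Each of the two predicates determines its form, as [red] and [dd_cot] are surjective; a common
   witness therefore identifies gamma with gamma'. *)
- exists (chi_gamma chi), (chi_gamma chi).
  by split=> //; [apply: chi_gammaP | apply: qfsha_chi_gamma].
Qed.
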